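(* Let $A=[a_{i,j}]_{i,j\ge1}$ be the infinite matrix defined by $a_{1,j}=2$ for $j>1$; $a_{i,j}=a_{i-1,j}+a_{i,j-1}+a_{i-1,j-1}$ for $i>1$, $j>i+1$; $a_{i,i+1}=a_{i-1,i+1}+a_{i-1,i}+2(-1)^{i-1}$ for $i>1$; and $a_{i,j}=-a_{j,i}$ for $j\le i$ (so $a_{i,i}=0$). Then for every integer $n\ge1$ and every set $I=\{i_1,\dots,i_r\}$ with $1\le i_1<\dots<i_r\le n$ ($r\ge1$), $$|O(n;I)|=\operatorname{pf}(A_I),$$ where $A_I$ is the submatrix of $A$ with rows and columns indexed by $I$.
   Context: Aztec diamond: $AD(n)$ is the union of the closed unit squares $[a,a+1]\times[b,b+1]$ ($a,b\in\mathbb{Z}$) with $|a+\tfrac12|+|b+\tfrac12|\le n$; we refer to such a square by its lower-left corner $(a,b)$. Color the square $(a,b)$ black if $a+b\equiv n-1 \pmod 2$ and white otherwise. For $i=1,\dots,n$, the $i$-th diagonal cell is the $2\times2$ block of the four unit squares with lower-left corners $(-1,2i-n-2),(0,2i-n-1),(-1,2i-n-1),(0,2i-n-2)$; a domino is completely contained in the cell if both its squares are among these four. For $\ell=1,\dots,n$, the $\ell$-th southwestern boundary square is the square $(-\ell,\ell-n-1)$ and its mirror image under $x\mapsto -x$ is the square $(\ell-1,\ell-n-1)$. For $I\subseteq\{1,\dots,n\}$, $R(n;I)$ is obtained from $AD(n)$ by removing, for each $\ell\notin I$, the $\ell$-th southwestern boundary square and its mirror image. $O(n;I)$ is the set of domino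 tilings of $R(n;I)$ that are invariant under the reflection $x\mapsto-x$ and in which each of the $n$ diagonal cells contains exactly one complete domino. Pfaffian of a $2m\times2m$ skew-symmetric $M$: $\operatorname{pf}(M)=\sum_\sigma\operatorname{sgn}(\sigma)\prod_{k=1}^m M_{\sigma_{2k-1},\sigma_{2k}}$ over perfect matchings of $\{1,\dots,2m\}$ written with $\sigma_{2k-1}<\sigma_{2k}$ and $\sigma_1<\sigma_3<\cdots$, $\operatorname{sgn}(\sigma)$ being the sign of $k\mapsto\sigma_k$; the Pfaffian of an odd-order skew-symmetric matrix is $0$. *)

(* Defs.v *)
From mathcomp Require Import all_boot all_order all_algebra all_fingroup.
From mathcomp Require Import zify lra.

Set Implicit Arguments.
Unset Strict Implicit.
Unset Printing Implicit Defensive.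

Import Order.TTheory GRing.Theory Num.Theory.
Local Open Scope ring_scope.

(* The unit squares [a,a+1]x[b,b+1] with -n <= a, b <= n-1, that is, those of
   the box [-n,n]x[-n,n], stored with coordinates shifted by n.  By
   [in_boxP] the box contains every square of AD(n); all the definitions below
   use the true coordinates [corner s = (a, b)] of the lower-left corner. *)
Definition square (n : nat) : finType := ('I_n.*2 * 'I_n.*2)%type.

Definition corner n (s : square n) : int * int :=
  (s.1%:Z - n%:Z, s.2%:Z - n%:Z).

Definition AD_cond (n : nat) (p : int * int) : bool :=
  `|p.1%:Q + 2^-1| + `|p.2%:Q + 2^-1| <= n%:Q.

Lemma in_boxP n (p : int * int) :
  AD_cond n p -> exists s : square n, corner s = p.
Proof.
case: p => a b; rewrite /AD_cond /= => H.
have bnd (c : int) : `|c%:Q + 2^-1| <= n%:Q ->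
    exists i : 'I_n.*2, i%:Z - n%:Z = c.
  move=> /[1!ler_norml] /andP[lo hi].
  have lo' : - n%:Z - 1 < c.
    rewrite -(ltr_int rat) intrD intrN; lra.
  have hi' : c < n%:Z by rewrite -(ltr_int rat); lra.
  have lt_i : (`|(c + n%:Z)%R|%N < n.*2)%N by lia.
  exists (Ordinal lt_i) => /=; lia.
have [i <-] : exists i : 'I_n.*2, i%:Z - n%:Z = a.
  by apply: bnd; apply: le_trans H; rewrite lerDl.
have [j <-] : exists j : 'I_n.*2, j%:Z - n%:Z = b.
  by apply: bnd; apply: le_trans H; rewrite lerDr.
by exists (i, j).
Qed.

Definition AD (n : nat) : {set square n} := [set s | AD_cond n (corner s)].

(* The reflection x |-> -x, which sends the square (a,b) to (-a-1,b). *)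
Definition mirror n (s : square n) : square n := (rev_ord s.1, s.2).

Lemma corner_mirror n (s : square n) :
  corner (mirror s) = (- (corner s).1 - 1, (corner s).2).
Proof.
by case: s => i j; rewrite /corner /=; congr pair; have := ltn_ord i; lia.
Qed.

Definition adjacent n (s t : square n) : bool :=
  `|(corner s).1 - (corner t).1| + `|(corner s).2 - (corner t).2| == 1.

Definition domino n (d : {set square n}) : bool :=
  [exists s, exists t, adjacent s t && (d == [set s; t])].

Definition tiling n (R : {set square n}) (T : {set {set square n}}) : bool :=
  partition T R && [forall d in T, domino d].

Definition mirror_invariant n (T : {set {set square n}}) : bool :=
  [set @mirror n @: d | d : {set square n} in T] == T.

Definition diagonal_cell (n i : nat) : {set square n} :=
  [set s | corner s \in
     [:: (- 1, 2 * i%:Z - n%:Z - 2); (0, 2 * i%:Z - n%:Z - 1);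
         (- 1, 2 * i%:Z - n%:Z - 1); (0, 2 * i%:Z - n%:Z - 2)]].

Definition sw_boundary (n l : nat) : {set square n} :=
  [set s | corner s == (- l%:Z, l%:Z - n%:Z - 1)].

Definition se_boundary (n l : nat) : {set square n} :=
  [set s | corner s == (l%:Z - 1, l%:Z - n%:Z - 1)].

Definition region (n : nat) (I : seq nat) : {set square n} :=
  AD n :\: \bigcup_(1 <= l < n.+1 | l \notin I)
             (sw_boundary n l :|: se_boundary n l).

Definition symmetric_tilings (n : nat) (I : seq nat) :
    {set {set {set square n}}} :=
  [set T | [&& tiling (region n I) T, mirror_invariant T &
     all (fun i => #|[set d in T | d \subset diagonal_cell n i]| == 1%N)
         (iota 1 n)]].

(* Indices are 0-based: the k-th pair sigma_(2k-1) < sigma_(2k) of the perfect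
   matching is s j < s (j+1) with j = 2k-2 even.  The successor [ordS] is
   cyclic, but it does not wrap around at an even j < n when n is even. *)
Definition matching_perm n (s : 'S_n) : bool :=
  [forall k : 'I_n, ~~ odd k ==> (s k < s (ordS k))%N] &&
  [forall k : 'I_n, forall l : 'I_n,
     [&& ~~ odd k, ~~ odd l & (k < l)%N] ==> (s k < s l)%N].

Definition pf (R : comNzRingType) n (M : 'M[R]_n) : R :=
  if odd n then 0 else
  \sum_(s : 'S_n | matching_perm s)
     (-1) ^+ s * \prod_(k < n | ~~ odd k) M (s k) (s (ordS k)).

(* The entries above the diagonal; rows and columns are numbered from 1, and
   the entries not above the diagonal are set to 0. *)
Fixpoint upper_entry (i : nat) : nat -> int :=
  match i with
  | 0%N => fun=> 0
  | 1%N => fun j => if (1 < j)%N then 2 else 0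
  | i'.+1 =>
    fix row (j : nat) : int :=
      match j with
      | 0%N => 0
      | j'.+1 =>
        if (i < j')%N then upper_entry i' j + row j' + upper_entry i' j'
        else if j' == i then upper_entry i' j + upper_entry i' j' + 2 * (-1) ^+ i'
        else 0
      end
  end.

Definition A (i j : nat) : int :=
  if (i < j)%N then upper_entry i j else - upper_entry j i.

Lemma A_row1 j : (1 < j)%N -> A 1 j = 2.
Proof. by rewrite /A /= => ->. Qed.

Lemma A_rec i j : (1 < i)%N -> (i.+1 < j)%N ->
  A i j = A i.-1 j + A i j.-1 + A i.-1 j.-1.
Proof.
case: i => [|[|i]] // _; case: j => [|j] // lt_ij.
rewrite /A /=.
have -> : (i.+2 < j.+1)%N by lia.
have -> : (i.+1 < j.+1)%N by lia.
have lt_ij' : (i.+2 < j)%N by lia.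
have -> : (i.+1 < j)%N by lia.
by rewrite lt_ij'.
Qed.

Lemma A_superdiag i : (1 < i)%N ->
  A i i.+1 = A i.-1 i.+1 + A i.-1 i + 2 * (-1) ^+ i.-1.
Proof.
case: i => [|[|i]] // _; rewrite /A /= ltnn eqxx.
have -> : (i.+2 < i.+3)%N by lia.
have -> : (i.+1 < i.+3)%N by lia.
by have -> : (i.+1 < i.+2)%N by lia.
Qed.

Lemma A_diag i : A i i = 0.
Proof.
rewrite /A ltnn; case: i => [|[|i]] //=.
by rewrite ifF ?ifF ?oppr0 //; lia.
Qed.

Lemma A_skew i j : (j <= i)%N -> A i j = - A j i.
Proof.
rewrite leq_eqVlt => /orP[/eqP->|lt_ji]; first by rewrite A_diag oppr0.
by rewrite /A lt_ji ifF //; lia.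
Qed.

Definition A_sub (I : seq nat) : 'M[int]_(size I) :=
  \matrix_(p < size I, q < size I) A (nth 0%N I p) (nth 0%N I q).

(* Main.v *)
Require Import Defs.
From mathcomp Require Import all_boot all_order all_algebra all_fingroup.
From mathcomp Require Import zify ring.

(* A symmetric tiling is determined by its left half, whose squares are numbered
   in strips: the black squares (k, l) and the white squares (k, l), l = 1..n-k,
   k = 0..n-1, where black (k, l) touches white (k, l), white (k, l-1) of its own
   strip and only whites of strip k-1 besides.  The cell condition says that in
   each strip exactly one of the two squares (k, 1) is covered by a domino across
   the axis.  Let Z_k(S) be the number of half tilings of the strips >= k in which
   S is the set of black squares of strip k that are present; Z_k(S) turns out not
   to depend on k and to equal pf(A_S), by induction on the number of strips.
     Pfaffians of Gram matrices of an alternating form are multilinear alternating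
   functions of vectors.  Let A be the Gram matrix of (e_i) and F_u the sum of the
   e_s with 0 <= s < u, where e_0 is in the radical.  If U is the set of whites
   missing after the blacks of strip k are covered, the other whites leave in
   strip k+1 one black square in each interval [u, u') between consecutive elements
   of U, so multilinearity turns the sum over these choices into the Pfaffian of the
   differences F_u' - F_u, or of (star, F_u : u in U) for an extra vector star with
   (star, e_0) = 1 and (star, e_s) = 0 for s > 0.  A black s > 1 makes s or s-1 an
   element of U; by multilinearity again, with alternation killing the double
   choices, it contributes the vector h_s = F_s + F_(s-1).  The black 1 must cross
   the axis if present, and white 1 does otherwise.  The recursion defining A is
   what makes (h_s, h_t) = a_(s,t), and a_(1,t) = 2 is (star, h_t). *)

Set Implicit Arguments.
Unset Strict Implicit.
Unset Printing Implicit Defensive.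

Import Order.TTheory GRing.Theory Num.Theory.
Local Open Scope ring_scope.

(** * Recursive Pfaffians of sequences *)

Section DeleteAt.
Variable T : Type.
Implicit Types s : seq T.

Definition del i s := take i s ++ drop i.+1 s.

Lemma del_cons x i s : del i.+1 (x :: s) = x :: del i s.
Proof. by []. Qed.

Lemma size_del i s : (i < size s)%N -> size (del i s) = (size s).-1.
Proof. by move=> ltis; rewrite size_cat size_take size_drop ltis; lia. Qed.

Lemma nth_del x i s k : nth x (del i s) k = nth x s (bump i k).
Proof.
rewrite nth_cat size_take nth_drop /bump.
case: (ltnP i (size s)) => [ltis|leis].
  case: (ltnP k i) => [ltki|leik].
    by rewrite nth_take // leqNgt ltki.
  by congr nth; lia.
case: (ltnP k (size s)) => [ltks|lesk].
  by rewrite nth_take; [congr nth; lia | lia].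
by rewrite !nth_default //; lia.
Qed.

(** Makes a double expansion symmetric in its two deleted positions; [bump] and [unbump] renumber a
    position after the other deletion. *)
Lemma del_swap i j s : (i < size s)%N -> (j < (size s).-1)%N ->
  del j (del i s) = del (unbump (bump i j) i) (del (bump i j) s).
Proof.
case: s => [|x s] // lti ltj.
have ltb : (bump i j < size (x :: s))%N by rewrite /bump /= in lti ltj *; lia.
apply: (@eq_from_nth _ x) => [|k ltk].
  rewrite !size_del ?size_del //; rewrite /= /unbump /bump in lti ltj *; lia.
rewrite !nth_del; congr nth.
by rewrite /unbump /bump; lia.
Qed.

Lemma del_cat_l i s1 s2 :
  (i < size s1)%N -> del i (s1 ++ s2) = del i s1 ++ s2.
Proof.
move=> lti; rewrite /del take_cat drop_cat lti.
case: ltnP => [_|ge]; first by rewrite catA.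
have -> : (i.+1 - size s1 = 0)%N by lia.
by rewrite drop0 (drop_oversize ge) cats0.
Qed.

Lemma del_cat_r i s1 s2 :
  del (size s1 + i)%N (s1 ++ s2) = s1 ++ del i s2.
Proof.
rewrite /del take_cat drop_cat ltnNge leq_addr /= addKn.
by rewrite ifF; [rewrite -addnS addKn catA | lia].
Qed.

End DeleteAt.

Lemma map_del (T1 T2 : Type) (g : T1 -> T2) i s :
  map g (del i s) = del i (map g s).
Proof. by rewrite /del map_cat map_take map_drop. Qed.

Section SeqPf.
Variables (R : comNzRingType) (T : Type).
Implicit Types (f : T -> T -> R) (s : seq T).

(** [m] is fuel: the expansion recurses on [del i s'], which is not a structural subterm. *)
Fixpoint seqpf_rec f m s : R :=
  match s, m with
  | [::], _ => 1
  | x :: s', m'.+1 =>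
      \sum_(i < size s') (-1) ^+ i * f x (nth x s' i) * seqpf_rec f m' (del i s')
  | _, 0%N => 0
  end.

Definition seqpf f s := seqpf_rec f (size s) s.

Lemma seqpf_rec_fuel f m s : (size s <= m)%N -> seqpf_rec f m s = seqpf f s.
Proof.
rewrite /seqpf; have [k] := ubnP (size s).
elim: k s m => // k IHk [|x s] [|m] //= ltsk lesm.
apply: eq_bigr => i _; have := ltn_ord i => lti.
by congr (_ * _); rewrite !IHk ?size_del //; lia.
Qed.

Lemma seqpf_nil f : seqpf f [::] = 1.
Proof. by []. Qed.

Lemma seqpf_cons f x s :
  seqpf f (x :: s) =
  \sum_(i < size s) (-1) ^+ i * f x (nth x s i) * seqpf f (del i s).
Proof.
rewrite /seqpf /=; apply: eq_bigr => i _; congr (_ * _).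
by rewrite seqpf_rec_fuel // size_del //; lia.
Qed.

Lemma seqpf_isolated f x s :
  (forall i, (i < size s)%N -> f x (nth x s i) = 0) -> seqpf f (x :: s) = 0.
Proof.
move=> fx0; rewrite seqpf_cons big1 // => i _.
by rewrite fx0 // mulr0 mul0r.
Qed.

Lemma seqpf_pendant f x y s :
  (forall i, (i < size s)%N -> f x (nth x s i) = 0) ->
  seqpf f (x :: y :: s) = f x y * seqpf f s.
Proof.
move=> fx0; rewrite seqpf_cons big_ord_recl /= big1 ?addr0 => [|i _].
  by rewrite expr0 mul1r /del /= drop0.
by rewrite (fx0 _ (ltn_ord i)) mulr0 mul0r.
Qed.

(** Expand along the first entry. If it is the split vector, each term is additive. Otherwise it is
    paired with the split vector, where [f] is additive, or leaves that vector in a shorter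
    sequence, where induction applies. *)
Lemma seqpf_add f s1 s2 x y z :
  (forall t, f t z = f t x + f t y) -> (forall t, f z t = f x t + f y t) ->
  seqpf f (s1 ++ z :: s2) = seqpf f (s1 ++ x :: s2) + seqpf f (s1 ++ y :: s2).
Proof.
move=> fr fl; have [k] := ubnP (size (s1 ++ s2)).
elim: k s1 s2 => // k IHk [|w s1] s2 ltk.
  rewrite /= !seqpf_cons -big_split /=; apply: eq_bigr => i _.
  rewrite (set_nth_default x z) // (set_nth_default x y) // fl.
  by rewrite mulrDr mulrDl.
rewrite /= !seqpf_cons !size_cat /=.
rewrite -big_split /=; apply: eq_bigr => -[i lti] _ /=.
case: (ltngtP i (size s1)) => [lt1|gt1|eqi].
- rewrite !nth_cat lt1 !del_cat_l // IHk ?mulrDr //.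
  by rewrite size_cat size_del //; move: ltk; rewrite /= size_cat; lia.
- have -> : i = (size s1 + (i - size s1).-1.+1)%N by lia.
  rewrite !nth_cat ltnNge leq_addr /= addKn /= !del_cat_r.
  rewrite !del_cons IHk ?mulrDr //.
  move: ltk; rewrite /= size_cat => ltk.
  by rewrite size_cat size_del; lia.
rewrite {i}eqi in lti *.
rewrite !nth_cat ltnn subnn /= fr.
have dE t : del (size s1) (s1 ++ t :: s2) = s1 ++ s2.
  by rewrite -[X in del X _]addn0 del_cat_r /del /= drop0.
by rewrite !dE mulrDr mulrDl.
Qed.

End SeqPf.

(** If the two copies come first, the double expansion is antisymmetric in their partners. Otherwise
    expand along the first entry: other partners leave a shorter instance, and the two copies give
    opposite terms. *)
Lemma seqpf_alt (T : Type) (f : T -> T -> int) s1 s2 x :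
  f x x = 0 -> seqpf f (s1 ++ x :: x :: s2) = 0.
Proof.
move=> fxx; have [k] := ubnP (size (s1 ++ s2)).
elim: k s1 s2 => // k IHk [|w s1] s2 ltk.
  rewrite /= seqpf_cons big_ord_recl /= fxx mulr0 mul0r add0r.
  case: s2 ltk => [|a s] ltk; first by rewrite big_ord0.
  set s2 := a :: s; set m := size s.
  (* The term in which the two copies are paired with entries [i] and [j] of [s2]; the value 0 at
     [i = j] is a filler. *)
  pose G (i j : 'I_m.+1) : int := if j == i then 0 else
    (-1) ^+ (i + unbump i j)%N * (f x (nth x s2 i) * f x (nth x s2 j)) *
    seqpf f (del (unbump i j) (del i s2)).
  transitivity (- \sum_(i < m.+1) \sum_(j < m.+1) G i j).
    rewrite -sumrN; apply: eq_bigr => i _.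
    rewrite [in RHS](bigD1_ord i) //= {1}/G eqxx add0r.
    have -> : del (bump 0 i) (x :: s2) = x :: del i s2 by [].
    rewrite seqpf_cons size_del //= /bump /= add1n exprS.
    rewrite -mulrA mulN1r mulNr mulrA big_distrr /=; congr (- _).
    apply: eq_bigr => j _; rewrite /G eq_sym (negbTE (neq_lift _ _)) /=.
    by rewrite nth_del bumpK exprD; ring.
  suff : \sum_(i < m.+1) \sum_(j < m.+1) G i j =
    - \sum_(i < m.+1) \sum_(j < m.+1) G i j by lia.
  rewrite [LHS]exchange_big -sumrN; apply: eq_bigr => i _.
  rewrite -sumrN; apply: eq_bigr => j _; rewrite /G eq_sym.
  case: eqVneq => [|neqij]; first by rewrite oppr0.
  have nij : (i : nat) != j by rewrite ?neqij // eq_sym neqij.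
  have lti := ltn_ord i; have ltj := ltn_ord j.
  rewrite (@del_swap _ j) /=; first last.
  - rewrite /unbump; move: nij lti ltj; rewrite -/m; lia.
  - by [].
  have -> : bump j (unbump j i) = i by rewrite unbumpK // inE.
  have -> : (-1) ^+ (i + unbump i j)%N = - (-1) ^+ (j + unbump j i)%N :> int.
    rewrite -!(signr_odd _ (_ + _)%N) /unbump.
    have -> : odd (j + (i - (j < i)))%N = ~~ odd (i + (j - (i < j)))%N by lia.
    by case: odd; rewrite ?expr0 ?expr1 ?opprK.
  by ring.
rewrite /= seqpf_cons size_cat /=.
have sz : (size s1 + (size s2).+2 = size s1 + (2 + size s2))%N by [].
rewrite sz !big_split_ord /= big_ord_recl /= big_ord_recl /= big_ord0.
rewrite big1 ?add0r => [|[i lti] _ /=]; last first.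
  rewrite del_cat_l // IHk ?mulr0 //.
  by rewrite size_cat size_del //; move: ltk; rewrite /= size_cat; lia.
rewrite [X in _ + X]big1 ?addr0 => [|[i lti] _ /=]; last first.
  rewrite del_cat_r !del_cons IHk ?mulr0 //.
  by rewrite size_cat size_del //; move: ltk; rewrite /= size_cat; lia.
rewrite !del_cat_r !nth_cat !ltnNge !leq_addr !addKn /= /del /= drop0.
by rewrite /bump /= addnS exprS addn0; ring.
Qed.

(** * Expansion of the Pfaffian of a matrix along its first row *)

Lemma lift_perm_onto n (i : 'I_n.+1) (s : 'S_n.+1) :
  exists s', s = lift_perm i (s i) s'.
Proof.
pose u k := odflt k (unlift (s i) (s (lift i k))).
have uK k : lift (s i) (u k) = s (lift i k).
  rewrite /u; have := neq_lift i k.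
  by rewrite -(can_eq (permK s)) => /unlift_some[] ? ? ->.
have u_inj : injective u.
  by move=> k k' /(congr1 (lift (s i))); rewrite !uK => /perm_inj/lift_inj.
exists (perm u_inj); apply/permP => k.
case: (unliftP i k) => [k'|] ->; last by rewrite lift_perm_id.
by rewrite lift_perm_lift permE uK.
Qed.

Lemma lift_perm_inj n (i j j' : 'I_n.+1) (s s' : 'S_n) :
  lift_perm i j s = lift_perm i j' s' -> j = j' /\ s = s'.
Proof.
move=> eqs; have eqj : j = j'.
  by have /permP/(_ i) := eqs; rewrite !lift_perm_id.
split=> //; apply/permP => k; apply: (@lift_inj _ j).
by rewrite -(lift_perm_lift i) eqs lift_perm_lift eqj.
Qed.

Section PfExpansion.
Variable n : nat.

(** The matching that pairs the first index with the [j]-th of the others and follows [s] on the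
    rest. *)
Definition lift_pair (j : 'I_n.+1) (s : 'S_n) : 'S_n.+2 :=
  lift_perm ord0 ord0 (lift_perm ord0 j s).

Lemma lift_pair0 j s : lift_pair j s ord0 = ord0.
Proof. by rewrite /lift_pair lift_perm_id. Qed.

Lemma lift_pair1 j s : lift_pair j s (lift ord0 ord0) = lift ord0 j.
Proof. by rewrite /lift_pair lift_perm_lift lift_perm_id. Qed.

Lemma lift_pair2 j s k :
  lift_pair j s (lift ord0 (lift ord0 k)) = lift ord0 (lift j (s k)).
Proof. by rewrite /lift_pair !lift_perm_lift. Qed.

Lemma odd_lift_pair j s : lift_pair j s = odd j (+) s :> bool.
Proof. by rewrite /lift_pair !odd_lift_perm. Qed.

Lemma ordS_lift2 (k : 'I_n) : ~~ odd n -> ~~ odd k ->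
  ordS (lift ord0 (lift ord0 k)) = lift ord0 (lift ord0 (ordS k)).
Proof.
move=> even_n even_k; apply: val_inj; rewrite /= /bump /=.
by have ltk := ltn_ord k; rewrite !modn_small; lia.
Qed.

(** If 0 were taken at an odd position, the start of that pair would be smaller; at a positive even
    position, the start of the first pair would be. *)
Lemma matching_perm0 (s : 'S_n.+2) :
  ~~ odd n -> matching_perm s -> s ord0 = ord0.
Proof.
move=> even_n /andP[/forallP asc1 /forallP asc2].
have [k sk0] : exists k, s k = ord0 by exists (s^-1%g ord0); rewrite permKV.
suff k0 : k = ord0 by rewrite -[in LHS]k0.
have ltk := ltn_ord k.
case: (boolP (odd k)) => odd_k.
  have lt_k1 : (k.-1 < n.+2)%N by lia.
  have := asc1 (Ordinal lt_k1); have -> : ordS (Ordinal lt_k1) = k.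
    by apply: val_inj; rewrite /= modn_small; lia.
  by rewrite sk0 ltn0 implybF negbK /=; lia.
have /forallP/(_ k) := asc2 ord0; rewrite sk0 ltn0 implybF /= odd_k.
by case: (posnP k) => // k0 _; apply: val_inj.
Qed.

(** The conditions that involve the first pair are automatic, since its first value is 0. *)
Lemma matching_lift_pair j (s : 'S_n) : ~~ odd n ->
  matching_perm (lift_pair j s) = matching_perm s.
Proof.
move=> even_n; have lt2 (a b : 'I_n) :
    (lift_pair j s (lift ord0 (lift ord0 a)) <
     lift_pair j s (lift ord0 (lift ord0 b)))%N = (s a < s b)%N.
  by rewrite !lift_pair2 /= /bump; lia.
apply/andP/andP => -[/forallP asc1 /forallP asc2]; split; apply/forallP => k.
- apply/implyP => even_k; rewrite -lt2 -ordS_lift2 //.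
  by have /implyP := asc1 (lift ord0 (lift ord0 k)); apply; rewrite /= /bump; lia.
- apply/forallP => l; apply/implyP => /and3P[even_k even_l lt_kl].
  rewrite -lt2; have /forallP/(_ (lift ord0 (lift ord0 l)))/implyP :=
    asc2 (lift ord0 (lift ord0 k)).
  by apply; rewrite /= /bump; lia.
- apply/implyP; case: (unliftP ord0 k) => [k'|] -> even_k; last first.
    have -> : ordS ord0 = lift ord0 ord0 :> 'I_n.+2 by apply: val_inj.
    by rewrite lift_pair0 lift_pair1.
  case: (unliftP ord0 k') even_k => [k''|] -> even_k; last by [].
  rewrite ordS_lift2 ?lt2 //; last by move: even_k; rewrite /= /bump; lia.
  by have /implyP := asc1 k''; apply; move: even_k; rewrite /= /bump; lia.
apply/forallP => l; apply/implyP => /and3P[].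
case: (unliftP ord0 k) => [k'|] -> even_k; last first.
  case: (unliftP ord0 l) => [l'|] -> _; last by rewrite ltn0.
  case: (unliftP ord0 l') => [l''|] -> _.
    by rewrite lift_pair0 lift_pair2.
  by rewrite lift_pair0 lift_pair1.
case: (unliftP ord0 k') even_k => [k''|] -> even_k; last by [].
case: (unliftP ord0 l) => [l'|] ->; last by rewrite ltn0.
case: (unliftP ord0 l') => [l''|] -> even_l lt_kl; last by [].
have /forallP/(_ l'')/implyP := asc2 k''; rewrite lt2; apply.
by move: even_k even_l lt_kl; rewrite /= /bump; lia.
Qed.

End PfExpansion.

(** For even [n], [lift_pair] reindexes the matchings by the partner of the first index and a
    matching of the rest, with sign [(-1) ^+ j]. *)
Lemma pf_expand (R : comNzRingType) n (M : 'M[R]_n.+2) :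
  pf M = \sum_(j < n.+1) (-1) ^+ j * M ord0 (lift ord0 j) *
    pf (\matrix_(a < n, b < n)
         M (lift ord0 (lift j a)) (lift ord0 (lift j b))).
Proof.
rewrite /pf /= negbK; case: ifP => [_|/negbT even_n].
  by rewrite big1 // => j _; rewrite mulr0.
under [RHS]eq_bigr => j _ do rewrite big_distrr /=.
rewrite pair_big /=.
pose h (p : 'I_n.+1 * 'S_n) := lift_pair p.1 p.2.
rewrite (eq_bigl (fun s => s \in h @: [set p | matching_perm p.2])); last first.
  move=> s; apply/idP/imsetP => [match_s|[p]]; last first.
    by rewrite inE => match_p ->; rewrite matching_lift_pair.
  have [s1 def_s] := lift_perm_onto ord0 s.
  rewrite matching_perm0 // in def_s.
  have [s2 def_s1] := lift_perm_onto ord0 s1.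
  have def_s2 : s = lift_pair (s1 ord0) s2 by rewrite /lift_pair -def_s1.
  exists (s1 ord0, s2); rewrite ?inE //=.
  by rewrite -(matching_lift_pair (s1 ord0)) // -def_s2.
rewrite big_imset /=; last first.
  by move=> [j s] [j' s'] _ _ /lift_perm_inj[_ /lift_perm_inj[/= -> ->]].
apply: eq_big => [[j s]|[j s] _]; first by rewrite inE.
rewrite /h /= odd_lift_pair signr_addb signr_odd -!mulrA; congr (_ * _).
rewrite big_mkcond big_ord_recl /= lift_pair0.
have -> : ordS ord0 = lift ord0 ord0 :> 'I_n.+2 by apply: val_inj.
rewrite lift_pair1 [RHS]mulrCA; congr (_ * _).
congr (_ * _).
rewrite big_ord_recl /= mul1r [in RHS]big_mkcond /=.
apply: eq_bigr => k _; rewrite /bump /= add0n !negbK.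
case: ifP => // even_k; rewrite mxE lift_pair2.
by rewrite ordS_lift2 // lift_pair2.
Qed.

Lemma pf_seqpf (R : comNzRingType) (T : Type) (f : T -> T -> R) x (s : seq T) :
  pf (\matrix_(i < size s, j < size s) f (nth x s i) (nth x s j)) = seqpf f s.
Proof.
have [n] := ubnP (size s).
elim: n s => // n IHn [|a [|b s]] lt_n.
- rewrite /pf /= seqpf_nil (big_pred1 1%g) => [|s].
    by rewrite odd_perm1 big_ord0 mulr1.
  rewrite /= eqE /=; apply/andP/eqP => [_|_].
    by apply/ffunP => -[].
  by split; apply/forallP => -[].
- by rewrite seqpf_cons big_ord0.
rewrite seqpf_cons pf_expand; apply: eq_bigr => j _; rewrite mxE /=.
rewrite (set_nth_default x) //; congr (_ * _).
have ltj : (j < size (b :: s))%N := ltn_ord j.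
rewrite -IHn; last by rewrite size_del //=; move: lt_n => /=; lia.
move: (size_del ltj); rewrite /= => sz.
(* The orders [size (del j (b :: s))] and [size s] are equal only propositionally, so entries are
   compared through the values of the ordinals. *)
have eqM (m : nat) (M : 'M[R]_(size s)) (M' : 'M[R]_m) : m = size s ->
    (forall (i k : 'I_(size s)) (i' k' : 'I_m),
      val i = val i' -> val k = val k' -> M i k = M' i' k') -> pf M = pf M'.
  move=> eqm; case: _ / (esym eqm) in M' * => eqM.
  by congr pf; apply/matrixP => i k; apply: eqM.
apply: eqM => // i k i' k' eqi eqk; rewrite !mxE !nth_del.
by rewrite /= eqi eqk.
Qed.

(** * The matrix [A] and its bilinear form *)

Lemma A_0l j : A 0 j = 0.
Proof. by case: j. Qed.

Lemma A_0r i : A i 0 = 0.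
Proof. by rewrite A_skew // A_0l oppr0. Qed.

(** What the three-term recursion for [A] leaves over. *)
Definition defect (s t : nat) : int :=
  A s.+1 t.+1 - A s t.+1 - A s.+1 t - A s t.

Lemma defect_skew s t : defect t s = - defect s t.
Proof.
rewrite /defect; have sk i j : A i j = - A j i.
  by case: (leqP j i) => [/A_skew//|/ltnW/A_skew->]; rewrite opprK.
by rewrite (sk t.+1) (sk t s.+1) (sk t.+1 s) (sk t s); ring.
Qed.

(** As index 0 carries zeros, row 1 obeys the recursion too: its value 2 is the superdiagonal
    correction at [s = 0]. *)
Lemma defectE s t : (s <= t)%N ->
  defect s t = if t == s.+1 then 2 * (-1) ^+ s else 0.
Proof.
rewrite leq_eqVlt => /orP[/eqP ->|].
  rewrite /defect !A_diag (A_skew (leqnSn _)) ifF; [ring | lia].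
rewrite leq_eqVlt => /orP[/eqP <-|lt_st].
  rewrite eqxx; case: s => [|s]; first by rewrite /defect !A_0l A_row1.
  by rewrite /defect A_superdiag // A_diag /=; ring.
rewrite ifF; last by lia.
case: s lt_st => [|s] lt_st; first by rewrite /defect !A_0l !A_row1 //; lia.
by rewrite /defect (@A_rec s.+2) //=; ring.
Qed.

(** The correction alternates in sign along the superdiagonal; this is the property that
    [psumA_four] needs. *)
Lemma defectS s t : defect s.+1 t.+1 = - defect s t.
Proof.
wlog le_st : s t / (s <= t)%N => [hw|].
  case: (leqP s t) => [le_st|/ltnW le_ts]; first exact: hw.
  by rewrite defect_skew hw // [defect s t]defect_skew.
by rewrite !defectE //; rewrite eqSS; case: eqP => _; rewrite ?exprS; ring.
Qed.

Definition psumA (u v : nat) : int := \sum_(i < u) \sum_(j < v) A i j.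

Lemma psumA_diff u v :
  psumA u.+1 v.+1 = psumA u v.+1 + psumA u.+1 v - psumA u v + A u v.
Proof. by rewrite /psumA !big_ord_recr /=; ring. Qed.

Lemma psumA_0l v : psumA 0 v = 0.
Proof. by rewrite /psumA big_ord0. Qed.

Lemma psumA_1l v : psumA 1 v = 0.
Proof. by rewrite /psumA big_ord1 big1 // => j _; rewrite A_0l. Qed.

Lemma psumA_0r u : psumA u 0 = 0.
Proof. by rewrite /psumA big1 // => i _; rewrite big_ord0. Qed.

Lemma psumA_1r u : psumA u 1 = 0.
Proof. by rewrite /psumA big1 // => i _; rewrite big_ord1 A_0r. Qed.

(* By [defectS] the second mixed difference of the two sides agrees, so it is
   enough to compare them along the borders [s = 0] and [t = 0]. *)
Lemma psumA_four s t :
  psumA s.+2 t.+2 + psumA s.+1 t.+2 + psumA s.+2 t.+1 + psumA s.+1 t.+1 =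
  A s.+2 t.+2.
Proof.
pose H s t := psumA s.+1 t.+1 + psumA s t.+1 + psumA s.+1 t + psumA s t
  - A s.+1 t.+1.
have HS i j : H i.+1 j.+1 = H i j.+1 + H i.+1 j - H i j.
  have := defectS i j; rewrite /H /defect => dS.
  rewrite (psumA_diff i.+1 j.+1) (psumA_diff i j.+1) (psumA_diff i.+1 j).
  by rewrite (psumA_diff i j); lia.
(* The borders are -2 and 2 off the corner, where [H] is 0; with zero mixed differences they cancel
   in every [H s.+1 t.+1]. *)
have H0l j : H 0%N j = - 2 * (0 < j)%N%:Z.
  rewrite /H !psumA_0l !psumA_1l; case: j => [|j]; first by rewrite A_diag.
  by rewrite A_row1 //.
have H0r i : H i 0%N = 2 * (0 < i)%N%:Z.
  rewrite /H !psumA_0r !psumA_1r; case: i => [|i]; first by rewrite A_diag.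
  by rewrite A_skew // A_row1.
suff : H s.+1 t.+1 = 0 by rewrite /H => /eqP; rewrite subr_eq0 => /eqP.
elim: s t => [|s IHs] t; elim: t => [|t IHt]; rewrite HS ?IHs ?IHt ?H0l ?H0r //=.
Qed.

(** * The alternating form with the extra vector *)

Section Form.
Variable M : nat.
Implicit Types u v w : nat -> int.

(* Index [0] carries the extra vector [star]; index [i.+1] carries the basis
   vector [e_i], on which the form is [A]. *)
Definition border (i j : nat) : int :=
  match i, j with
  | i'.+1, j'.+1 => A i' j'
  | _, _ => (j == 1%N)%:R - (i == 1%N)%:R
  end.

(** Vectors are functions on all naturals, of which the form reads the first [M] coordinates. *)
Definition bform u v : int := \sum_(i < M) \sum_(j < M) u i * v j * border i j.

Lemma border_skew i j : border j i = - border i j.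
Proof.
case: i j => [|i] [|j] /=; rewrite ?opprB //.
by case: (leqP i j) => [le|/ltnW le]; [|rewrite -[LHS]opprK; congr (- _)];
  rewrite -A_skew.
Qed.

Lemma bform_skew u v : bform v u = - bform u v.
Proof.
rewrite /bform exchange_big -sumrN; apply: eq_bigr => i _.
by rewrite -sumrN; apply: eq_bigr => j _; rewrite border_skew; ring.
Qed.

Lemma bform_alt u : bform u u = 0.
Proof. by have := bform_skew u u; lia. Qed.

Lemma bform_addr u v w t : (forall i, w i = u i + v i) ->
  bform t w = bform t u + bform t v.
Proof.
move=> defw; rewrite /bform -big_split; apply: eq_bigr => i _ /=.
by rewrite -big_split; apply: eq_bigr => j _ /=; rewrite defw; ring.
Qed.

Lemma bform_addl u v w t : (forall i, w i = u i + v i) ->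
  bform w t = bform u t + bform v t.
Proof.
by move=> defw; rewrite !(bform_skew t) (bform_addr t defw) opprD.
Qed.

Definition star (i : nat) : int := (i == 0%N)%:R.
(* The sum of the [e_s] with [x <= s < y]. *)
Definition dvec (x y i : nat) : int := (x < i <= y)%N%:R.
Definition evec (s : nat) := dvec s s.+1.
Definition hvec (s i : nat) : int :=
  if s == 1%N then star i else dvec 0 s i + dvec 0 s.-1 i.

Lemma sum_dvec x y (g : nat -> int) : (y < M)%N ->
  \sum_(i < M) dvec x y i * g i = \sum_(x <= i < y) g i.+1.
Proof.
move=> ltyM; rewrite -(big_mkord predT (fun i => dvec x y i * g i)).
rewrite (big_cat_nat (leq0n y.+1)) //= [X in _ + X]big_nat_cond.
rewrite [X in _ + X]big1 ?addr0 => [|i]; last first.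
  by move=> /andP[/andP[lti _] _]; rewrite /dvec (_ : _ && _ = false) ?mul0r //; lia.
case: (leqP x y) => [lexy|ltyx]; last first.
  rewrite [RHS]big_geq 1?ltnW // big_nat_cond big1 // => i.
  move=> /andP[/andP[_ lti] _]; rewrite /dvec.
  by rewrite (_ : _ && _ = false) ?mul0r //; lia.
rewrite (big_cat_nat (leq0n x.+1)) //= big_nat_cond.
rewrite big1 ?add0r => [|i]; last first.
  by move=> /andP[/andP[_ lti] _]; rewrite /dvec (_ : _ && _ = false) ?mul0r //; lia.
rewrite big_add1 /=; apply: eq_big_nat => i lti.
by rewrite /dvec (_ : (_ < _ <= _)%N) ?mul1r //; lia.
Qed.

Lemma bform_star v : bform star v = (1 < M)%N%:R * v 1%N.
Proof.
rewrite /bform; case: (ltnP 1 M) => [lt1M|]; last first.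
  case: M => [|[|m]] // _; first by rewrite big_ord0 mul0r.
  by rewrite big_ord1 big_ord1 /= mulr0 mul0r.
rewrite mul1r (bigD1 (Ordinal (ltnW lt1M))) //= [X in _ + X]big1 ?addr0.
  rewrite (bigD1 (Ordinal lt1M)) //= big1 ?addr0; first by rewrite /star /=; ring.
  by move=> [[|[|j]] ltj] //= _; rewrite mulr0.
move=> i; rewrite -val_eqE /= => /negbTE i0.
by rewrite big1 // => j _; rewrite /star i0 !mul0r.
Qed.

Lemma bform_dd (u v : nat) : (u < M)%N -> (v < M)%N ->
  bform (dvec 0 u) (dvec 0 v) = psumA u v.
Proof.
move=> ltu ltv; rewrite /bform.
transitivity (\sum_(i < M) dvec 0 u i * \sum_(j < M) dvec 0 v j * border i j).
  by apply: eq_bigr => i _; rewrite big_distrr; apply: eq_bigr => j _ /=; ring.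
rewrite (sum_dvec _ (fun i => \sum_(j < M) dvec 0 v j * border i j)) //.
by rewrite big_mkord; apply: eq_bigr => i _; rewrite (sum_dvec _ (border i.+1)) // big_mkord.
Qed.

Lemma evecE s i : evec s i = (i == s.+1)%:R.
Proof. by rewrite /evec /dvec; congr (nat_of_bool _)%:R; lia. Qed.

Lemma bform_ee s t : (s.+1 < M)%N -> (t.+1 < M)%N ->
  bform (evec s) (evec t) = A s t.
Proof.
move=> lts ltt; rewrite /bform (bigD1 (Ordinal lts)) //= [X in _ + X]big1.
  rewrite (bigD1 (Ordinal ltt)) //= big1 ?addr0; first by rewrite !evecE !eqxx !mul1r.
  move=> j; rewrite -val_eqE /= => /negbTE nj.
  by rewrite !evecE nj mulr0 mul0r.
move=> i; rewrite -val_eqE /= => /negbTE ni.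
by rewrite big1 // => j _; rewrite !evecE ni !mul0r.
Qed.

(** [star] sees only e_0, which h_k contains twice for [k > 1]; this gives row 1. The other entries
    expand into the four block sums of [psumA_four]. *)
Lemma bform_hh s t : (0 < s < M)%N -> (0 < t < M)%N ->
  bform (hvec s) (hvec t) = A s t.
Proof.
have star_h k : (1 < k < M)%N -> bform star (hvec k) = 2.
  move=> /andP[lt1k ltkM]; rewrite bform_star /hvec /dvec.
  have -> : (k == 1%N) = false by lia.
  have -> : (1 < M)%N by lia.
  have -> : (0 < 1 <= k)%N by lia.
  by have -> : (0 < 1 <= k.-1)%N by lia.
move=> /andP[s0 ltsM] /andP[t0 lttM].
have h1 : hvec 1 = star by [].
case: s s0 ltsM => [|[|s]] // _ ltsM; case: t t0 lttM => [|[|t]] // _ lttM.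
- by rewrite bform_alt A_diag.
- by rewrite h1 star_h ?A_row1.
- by rewrite bform_skew h1 star_h // A_skew // A_row1.
have addh (k : nat) i : hvec k.+2 i = dvec 0 k.+2 i + dvec 0 k.+1 i by [].
rewrite (bform_addl _ (addh s)) !(bform_addr _ (addh t)) !bform_dd; try lia.
by rewrite -psumA_four; ring.
Qed.

End Form.

(** * Pfaffians of partial sums and of gaps *)

Lemma mem_del (U : eqType) i (s : seq U) : {subset del i s <= s}.
Proof.
by move=> x; rewrite mem_cat => /orP[/mem_take|/mem_drop].
Qed.

Lemma seqpf_map (R : comNzRingType) (T : Type) (U : eqType)
    (f : T -> T -> R) (f' : U -> U -> R) (g : U -> T) s :
  {in s &, forall a b, f (g a) (g b) = f' a b} ->
  seqpf f (map g s) = seqpf f' s.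
Proof.
have [n] := ubnP (size s); elim: n s => // n IHn [|a s] //= lt_n fE.
rewrite !seqpf_cons size_map; apply: eq_bigr => i _.
have lti := ltn_ord i.
rewrite (nth_map a) // fE ?mem_head ?inE ?mem_nth ?orbT //.
rewrite -map_del IHn //; first by rewrite size_del //; lia.
by move=> b c /mem_del sb /mem_del sc; apply: fE; rewrite inE ?sb ?sc orbT.
Qed.

Fixpoint gaps (x : nat) (s : seq nat) : seq (nat -> int) :=
  if s is y :: s' then dvec x y :: gaps y s' else [::].

Lemma dvecD x y z i : (x <= y <= z)%N -> dvec x z i = dvec x y i + dvec y z i.
Proof.
rewrite /dvec => lexyz.
have : ((x < i <= z) = (x < i <= y) + (y < i <= z) :> nat)%N by lia.
by move->; rewrite natrD.
Qed.

(** Each partial sum is the preceding one plus a gap, and the summand that repeats the preceding one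
    vanishes. *)
Lemma seqpf_gaps M pre x s : sorted leq (x :: s) ->
  seqpf (bform M) (pre ++ dvec 0 x :: map (dvec 0) s) =
  seqpf (bform M) (pre ++ dvec 0 x :: gaps x s).
Proof.
elim: s x pre => // y s IHs x pre /= /andP[lexy sorted_s].
rewrite -[LHS]/(seqpf _ (pre ++ dvec 0 x :: dvec 0 y :: map (dvec 0) s)).
rewrite -cat_rcons IHs //.
have eq_y : forall i, dvec 0 y i = dvec 0 x i + dvec x y i.
  by move=> i; apply: dvecD.
rewrite (seqpf_add _ _ (fun t => bform_addr M t eq_y) (fun t => bform_addl M t eq_y)).
by rewrite !cat_rcons seqpf_alt ?bform_alt // add0r.
Qed.

Lemma bform_star_gap M x y : (0 < x)%N -> bform M star (dvec x y) = 0.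
Proof.
by move=> x0; rewrite bform_star /dvec (_ : (x < 1)%N = false) ?mulr0; lia.
Qed.

(** The gaps avoid e_0, so [star] can only be paired with [dvec 0 x], with value 1. *)
Lemma seqpf_star_gaps M x s : (1 < M)%N -> (0 < x)%N -> sorted leq (x :: s) ->
  seqpf (bform M) (star :: map (dvec 0) (x :: s)) = seqpf (bform M) (gaps x s).
Proof.
move=> M1 x0 sorted_s.
have /= -> := seqpf_gaps M [:: star] sorted_s.
rewrite seqpf_pendant => [|i].
  by rewrite bform_star M1 /dvec x0 !mul1r.
elim: s x i x0 sorted_s => // y s IHs x [|i] x0 /= /andP[lexy sorted_s] lti.
  by rewrite bform_star_gap.
by apply: IHs => //; apply: leq_trans lexy.
Qed.

Lemma seqpf_hvec M s : {in s, forall i, (0 < i < M)%N} ->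
  seqpf (bform M) (map hvec s) = seqpf A s.
Proof. by move=> rng; apply: seqpf_map => i j /rng ? /rng ?; apply: bform_hh. Qed.

Lemma seqpf_star_hvec M s : {in s, forall i, (1 < i < M)%N} -> (1 < M)%N ->
  seqpf (bform M) (star :: map hvec s) = seqpf A (1%N :: s).
Proof.
move=> rng M1; rewrite -[star :: _]/(map hvec (1%N :: s)) seqpf_hvec //.
by move=> i; rewrite inE => /orP[/eqP ->//|/rng/andP[/ltnW -> ->]].
Qed.

(* The second vector is [e_0], a radical vector of [A]: only [star] pairs with
   it, so both disappear. *)
Lemma seqpf_star_d1_hvec M s : {in s, forall i, (1 < i < M)%N} -> (1 < M)%N ->
  seqpf (bform M) (star :: dvec 0 1 :: map hvec s) = seqpf A s.
Proof.
move=> rng M1; rewrite seqpf_cons big_ord_recl big1 /= => [|i _].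
  rewrite bform_star M1 /del /= drop0 !mul1r addr0 seqpf_hvec //.
  by move=> i /rng/andP[/ltnW -> ->].
rewrite del_cons seqpf_isolated ?mulr0 // => j.
have ltis : (0 + i < size (map hvec s))%N by have := ltn_ord i.
rewrite size_del // => ltj; rewrite nth_del.
rewrite size_map in ltj ltis.
have bump_lt a b c : (b < c.-1)%N -> (bump a b < c)%N by rewrite /bump; lia.
have ltb := bump_lt i _ _ ltj.
rewrite (nth_map 0%N) //; move: (mem_nth 0%N ltb) => /rng.
case: (nth 0%N s _) => [|[|k]] // /andP[_ ltk].
rewrite (@bform_addr _ (dvec 0 k.+2) (dvec 0 k.+1)) //.
by rewrite !bform_dd ?psumA_1l ?addr0 //; lia.
Qed.

(** * Removing dominoes from symmetric tilings *)

Section Tilings.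
Variable n : nat.
Notation square := (square n).
Implicit Types (R : {set square}) (d : {set square}) (T D : {set {set square}}).
Implicit Types (J : nat -> nat) (s t : square).

(** A quota [J] replaces the constant 1, so that removing dominoes stays within the family. *)
Definition valid_tilings R J : {set {set {set square}}} :=
  [set T | [&& tiling R T, mirror_invariant T &
     all (fun i => #|[set d in T | d \subset diagonal_cell n i]| == J i)
         (iota 1 n)]].

Lemma mirrorK : involutive (@mirror n).
Proof. by case=> a b; rewrite /mirror rev_ordK. Qed.

Lemma mirror_imset_inj : injective (fun d => @mirror n @: d).
Proof. by apply: imset_inj; apply: inv_inj; apply: mirrorK. Qed.

Lemma mirror_imsetK d : @mirror n @: (@mirror n @: d) = d.
Proof.
by rewrite -imset_comp (eq_imset _ mirrorK) imset_id.
Qed.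

Lemma mirror_invariantP T :
  reflect {in T, forall d, @mirror n @: d \in T} (mirror_invariant T).
Proof.
apply: (iffP eqP) => [eqT d dT|symT]; first by rewrite -{1}eqT imset_f.
apply/eqP; rewrite eqEcard card_imset ?leqnn ?andbT; last exact: mirror_imset_inj.
by apply/subsetP => _ /imsetP[d dT ->]; apply: symT.
Qed.

Lemma cells_U T D i : [disjoint T & D] ->
  #|[set d in T :|: D | d \subset diagonal_cell n i]| =
  (#|[set d in T | d \subset diagonal_cell n i]| +
   #|[set d in D | d \subset diagonal_cell n i]|)%N.
Proof.
move=> disj; rewrite -cardsUI [X in (_ = _ + X)%N](_ : _ = 0%N).
  rewrite addn0; apply: eq_card => d; rewrite !inE.
  by case: (d \in T); case: (d \in D); rewrite //= ?orbb ?orbF.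
apply: eq_card0 => d; rewrite !inE; apply/negP => /andP[/andP[dT _] /andP[dD _]].
by have /disjoint_setI0/setP/(_ d) := disj; rewrite !inE dT dD.
Qed.

(** Deleting and adding [D] are inverse bijections; as [D] is symmetric both keep mirror invariance,
    and the quota drops by the dominoes of [D] inside each cell. *)
Lemma card_valid_remove R J J' D :
  trivIset D -> {in D, forall d, domino d} -> mirror_invariant D ->
  cover D \subset R ->
  (forall i, (1 <= i <= n)%N ->
     J i = (#|[set d in D | d \subset diagonal_cell n i]| + J' i)%N) ->
  #|[set T in valid_tilings R J | D \subset T]| =
  #|valid_tilings (R :\: cover D) J'|.
Proof.
move=> trivD domD /mirror_invariantP symD subDR defJ.
have dom_n0 d : domino d -> d != set0.
  case/existsP => s /existsP[t /andP[_ /eqP ->]].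
  by apply/set0Pn; exists s; rewrite !inE eqxx.
have D0 : set0 \notin D by apply/negP => /domD/dom_n0; rewrite eqxx.
have disjD T : partition T (R :\: cover D) -> [disjoint T & D].
  move=> partT; rewrite disjoint_subset; apply/subsetP => d dT.
  rewrite inE; apply/negP => dD; have /set0Pn[x xd] := partition_neq0 partT dT.
  have := subsetP (partitionS partT dT) x xd; rewrite inE.
  by rewrite (subsetP (bigcup_sup _ dD) x xd).
suff -> : [set T in valid_tilings R J | D \subset T] =
    (fun T => T :|: D) @: valid_tilings (R :\: cover D) J'.
  rewrite card_in_imset // => T T'; rewrite !inE.
  move=> /and3P[/andP[/disjD dT _] _ _] /and3P[/andP[/disjD dT' _] _ _] eqTT'.
  have eqD (U : {set {set square}}) : [disjoint U & D] -> (U :|: D) :\: D = U.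
    move=> dU; rewrite setDUl setDv setU0; apply/setP => d; rewrite inE.
    by case: (boolP (d \in U)) => [/(disjointFr dU) -> //|]; rewrite andbF.
  by rewrite -(eqD _ dT) eqTT' eqD.
apply/setP => T; rewrite !inE; apply/andP/imsetP => [[]|[T']].
  move=> /and3P[/andP[partT /forall_inP domT] /mirror_invariantP symT /allP cellT] subDT.
  have eqT : (T :\: D) :|: D = T.
    apply/setP => d; rewrite !inE.
    by case: (boolP (d \in D)) => [/(subsetP subDT) ->|]; rewrite ?orbF.
  exists (T :\: D); last by rewrite eqT.
  have partTD : partition (T :\: D) (R :\: cover D).
    have trivT := partition_trivIset partT.
    rewrite /partition trivIsetD // inE (partition0 partT) andbF andbT.
    apply/eqP/setP => x; rewrite inE -(cover_partition partT).
    apply/bigcupP/andP => [[d]|[xnD /bigcupP[d dT xd]]].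
      rewrite inE => /andP[dnD dT] xd; split; last by apply/bigcupP; exists d.
      apply/negP => /bigcupP[d' d'D xd'].
      have := trivIsetP trivT d d' dT (subsetP subDT _ d'D).
      case: eqVneq => [eqd|_ /(_ isT)]; first by rewrite eqd d'D in dnD.
      by rewrite -setI_eq0 => /eqP/setP/(_ x); rewrite !inE xd xd'.
    exists d => //; rewrite inE dT andbT; apply: contra xnD => dD.
    by apply/bigcupP; exists d.
  rewrite inE; apply/and3P; split.
  - rewrite /tiling partTD; apply/forall_inP => d.
    by rewrite inE => /andP[_ /domT].
  - apply/mirror_invariantP => d; rewrite !inE => /andP[dnD /symT ->].
    by rewrite andbT; apply: contra dnD => /symD; rewrite mirror_imsetK.
  apply/allP => i i_in; have /eqP := cellT i i_in.
  rewrite -{1}eqT cells_U ?disjD // defJ; last by move: i_in; rewrite mem_iota; lia.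
  by rewrite addnC => /addnI ->.
rewrite inE => /and3P[/andP[partT /forall_inP domT] /mirror_invariantP symT /allP cellT] ->.
have dTD := disjD _ partT.
split; last exact: subsetUr.
apply/and3P; split.
- apply/andP; split; last first.
    by apply/forall_inP => d; rewrite inE => /orP[/domT|/domD].
  have cT := cover_partition partT.
  apply/and3P; split.
  + rewrite /cover bigcup_setU -/(cover _) -/(cover _) cT.
    by rewrite -[X in _ :|: X](setIidPr subDR) setUC setID eqxx.
  + apply: trivIsetU => //; first exact: partition_trivIset partT.
    by rewrite cT -setI_eq0 setIDAC setDIl setDv setI0.
  by rewrite inE negb_or (partition0 partT) D0.
- apply/mirror_invariantP => d; rewrite !inE.
  by case/orP => [/symT ->|/symD ->]; rewrite ?orbT.
apply/allP => i i_in; rewrite cells_U // (eqP (cellT i i_in)) addnC -defJ //.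
by move: i_in; rewrite mem_iota; lia.
Qed.

End Tilings.

(** * Coordinates of mirror-symmetric regions *)

Section Coordinates.
Variable n : nat.
Notation square := (square n).
Implicit Types (d : {set square}) (T D : {set {set square}}).
Implicit Types (J : nat -> nat) (s t : square) (P : nat -> nat -> bool).

(* The square with lower-left corner [(a, b)] lies in the [l]-th column from the
   axis, [l = - a] or [l = a + 1], and in row [b + n]. *)
Definition axis_dist s : nat :=
  if (s.1 < n)%N then (n - s.1)%N else (s.1.+1 - n)%N.

(** A predicate on column and row describes a symmetric region by its left half, so [remove] takes
    away a square together with its mirror image. *)
Definition region_of P : {set square} := [set s | P (axis_dist s) s.2].

Definition remove P l y : nat -> nat -> bool :=
  fun l' y' => P l' y' && ~~ ((l' == l) && (y' == y)).

Lemma axis_distP s : ((s.1 < n)%N /\ axis_dist s = n - s.1)%N \/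
  ((n <= s.1)%N /\ axis_dist s = s.1.+1 - n)%N.
Proof. by rewrite /axis_dist; case: ltnP; [left|right]. Qed.

Lemma mirror1 s : (mirror s).1 = (n.*2 - s.1.+1)%N :> nat.
Proof. by []. Qed.

Lemma mirror2 s : (mirror s).2 = s.2.
Proof. by []. Qed.

Lemma axis_dist_mirror s : axis_dist (mirror s) = axis_dist s.
Proof.
have lt1 := ltn_ord s.1.
by case: (axis_distP s) (axis_distP (mirror s)) => [[? ->]|[? ->]] [[]|[]];
  rewrite mirror1; lia.
Qed.

Lemma square_eq s t :
  (s == t) = ((s.1 == t.1 :> nat) && (s.2 == t.2 :> nat)).
Proof. by case: s t => a b [c d]. Qed.

Lemma same_coord s t :
  (axis_dist s == axis_dist t) && (s.2 == t.2 :> nat) =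
  (s == t) || (s == mirror t).
Proof.
have lt1 := ltn_ord s.1; have lt2 := ltn_ord t.1.
rewrite !square_eq mirror1 mirror2.
by case: (axis_distP s) (axis_distP t) => [[? ->]|[? ->]] [[? ->]|[? ->]]; lia.
Qed.

Lemma adjacentE s t : adjacent s t =
  ((s.1 == t.1 :> nat) && ((s.2.+1 == t.2 :> nat) || (t.2.+1 == s.2 :> nat))) ||
  ((s.2 == t.2 :> nat) && ((s.1.+1 == t.1 :> nat) || (t.1.+1 == s.1 :> nat))).
Proof. by rewrite /adjacent /corner /=; lia. Qed.

Lemma adjacent_sym s t : adjacent s t = adjacent t s.
Proof. by rewrite !adjacentE; lia. Qed.

Lemma adjacent_mirror s t : adjacent (mirror s) (mirror t) = adjacent s t.
Proof.
have lt1 := ltn_ord s.1; have lt2 := ltn_ord t.1.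
by rewrite !adjacentE !mirror1 !mirror2; lia.
Qed.

Lemma cellE i s :
  (s \in diagonal_cell n i) = (axis_dist s == 1%N) && ((s.2)./2.+1 == i).
Proof.
have lt1 := ltn_ord s.1.
rewrite inE !inE /corner !xpair_eqE.
by case: (axis_distP s) => [[? ->]|[? ->]]; lia.
Qed.

Lemma domino_pair d s : domino d -> s \in d ->
  exists2 t, adjacent s t & d = [set s; t].
Proof.
case/existsP => a /existsP[b /andP[adj /eqP ->]]; rewrite !inE.
case/orP => /eqP ->; first by exists b.
by exists a; rewrite 1?adjacent_sym // setUC.
Qed.

Lemma adjacent_neq s t : adjacent s t -> s != t.
Proof. by rewrite adjacentE square_eq; lia. Qed.

Lemma domino_set2 s t : adjacent s t -> domino [set s; t].
Proof.
by move=> adj; apply/existsP; exists s; apply/existsP; exists t; rewrite adj eqxx.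
Qed.

Lemma valid_tilingsP P J T : T \in valid_tilings (region_of P) J ->
  [/\ {in T, forall d, domino d},
      forall s, P (axis_dist s) s.2 -> exists2 d, d \in T & s \in d,
      {in T, forall d s, s \in d -> P (axis_dist s) s.2},
      {in T &, forall d d' s, s \in d -> s \in d' -> d = d'} &
      {in T, forall d, @mirror n @: d \in T}].
Proof.
rewrite inE => /and3P[/andP[partT /forall_inP domT] /mirror_invariantP symT _].
split=> //.
- move=> s Ps; have : s \in cover T by rewrite (cover_partition partT) inE.
  by case/bigcupP => d; exists d.
- by move=> d dT s sd; have := subsetP (partitionS partT dT) s sd; rewrite inE.
move=> d d' dT d'T s sd sd'.
have := trivIsetP (partition_trivIset partT) d d' dT d'T.
case: eqVneq => // _ /(_ isT).
by rewrite -setI_eq0 => /eqP/setP/(_ s); rewrite !inE sd sd'.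
Qed.

Lemma valid_cell P J T i : T \in valid_tilings (region_of P) J ->
  (1 <= i <= n)%N -> #|[set d in T | d \subset diagonal_cell n i]| = J i.
Proof.
rewrite inE => /and3P[_ _ /allP cellT] i_in; apply/eqP; apply: cellT.
by rewrite mem_iota; lia.
Qed.

(** The domino goes together with its mirror image, disjoint from it because [s] and [t] lie left of
    the axis. Neither is contained in a cell, so the quota stays. *)
Lemma card_pair_removal P J s t :
  (s.1 < n)%N -> (t.1 < n)%N -> adjacent s t ->
  ~~ ((axis_dist s == 1%N) && (axis_dist t == 1%N) && ((s.2)./2 == (t.2)./2)) ->
  P (axis_dist s) s.2 -> P (axis_dist t) t.2 ->
  #|[set T in valid_tilings (region_of P) J | [set s; t] \in T]| =
  #|valid_tilings (region_of
     (remove (remove P (axis_dist s) s.2) (axis_dist t) t.2)) J|.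
Proof.
move=> lts ltt adj not_cell Ps Pt; set d := [set s; t].
pose D := [set d; @mirror n @: d].
have mdE : @mirror n @: d = [set mirror s; mirror t] by rewrite imsetU1 imset_set1.
have coverD : cover D = d :|: @mirror n @: d by rewrite /cover bigcup_setU !big_set1.
have -> : [set T in valid_tilings (region_of P) J | d \in T] =
          [set T in valid_tilings (region_of P) J | D \subset T].
  apply/setP => T; rewrite [LHS]in_set [RHS]in_set; apply/andP/andP => -[TV].
    move=> dT; have [_ _ _ _ symT] : _ := valid_tilingsP TV.
    by split=> //; apply/subsetP => a; rewrite !inE => /orP[]/eqP->; last exact: symT.
  by move=> /subsetP sub; split=> //; apply: sub; rewrite !inE eqxx.
rewrite (@card_valid_remove _ _ _ J).
- congr #|pred_of_set (valid_tilings _ _)|; apply/setP => x.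
  rewrite coverD mdE !inE /remove !same_coord.
  case: (P (axis_dist x) x.2); rewrite ?andbF //=.
  by rewrite !negb_or; do !case: (_ == _).
- apply/trivIsetP => a b; rewrite !inE => /orP[]/eqP-> /orP[]/eqP->;
    rewrite ?eqxx // => _; rewrite mdE -setI_eq0; apply/eqP/setP => x.
    by rewrite !inE !square_eq !mirror1 !mirror2; lia.
  by rewrite !inE !square_eq !mirror1 !mirror2; lia.
- move=> a; rewrite !inE => /orP[]/eqP->; rewrite ?mdE;
    by apply: domino_set2; rewrite ?adjacent_mirror.
- apply/mirror_invariantP => a; rewrite !inE => /orP[]/eqP->.
    by rewrite eqxx orbT.
  by rewrite mirror_imsetK eqxx.
- rewrite coverD mdE; apply/subsetP => x; rewrite !inE -!orbA.
  by case/or4P => /eqP->; rewrite ?axis_dist_mirror.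
move=> i _; rewrite eq_card0 // => a; rewrite !inE; apply/negP.
move=> /andP[/orP[]/eqP-> /subsetP sub].
  have := sub s; have := sub t; rewrite !cellE !inE !eqxx orbT.
  by move=> /(_ isT) ? /(_ isT) ?; lia.
have := sub (mirror s); have := sub (mirror t).
rewrite mdE !cellE !inE !eqxx orbT !axis_dist_mirror /=.
by move=> /(_ isT) ? /(_ isT) ?; lia.
Qed.
End Coordinates.

(** * Peeling off a square or a cell *)

Section Peeling.
Variable n : nat.
Notation square := (square n).
Implicit Types (d : {set square}) (T D : {set {set square}}).
Implicit Types (J : nat -> nat) (s t : square) (P : nat -> nat -> bool).

Lemma mirror_imset2 s t : @mirror n @: [set s; t] = [set mirror s; mirror t].
Proof. by rewrite imsetU1 imset_set1. Qed.

(** A domino across the axis is its own mirror image: it goes alone and uses one unit of the quota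
    of its cell. *)
Lemma card_axis_removal P J J' s : axis_dist s = 1%N ->
  P (axis_dist s) s.2 ->
  (forall i, (1 <= i <= n)%N -> J i = (((s.2)./2.+1 == i) + J' i)%N) ->
  #|[set T in valid_tilings (region_of n P) J | [set s; mirror s] \in T]| =
  #|valid_tilings (region_of n (remove P (axis_dist s) s.2)) J'|.
Proof.
move=> s1 Ps defJ; set d := [set s; _]; pose D : {set {set square}} := [set d].
have coverD : cover D = d by rewrite cover1.
have adj : adjacent s (mirror s).
  have lt1 := ltn_ord s.1; rewrite adjacentE mirror1 mirror2.
  by case: (axis_distP s) => -[]; rewrite s1; lia.
have -> : [set T in valid_tilings (region_of n P) J | d \in T] =
          [set T in valid_tilings (region_of n P) J | D \subset T].
  by apply/setP => T; rewrite [LHS]in_set [RHS]in_set sub1set.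
rewrite (@card_valid_remove _ _ _ J').
- congr #|pred_of_set (valid_tilings _ _)|; apply/setP => x.
  rewrite coverD !inE /remove same_coord.
  by case: (P (axis_dist x) x.2); rewrite ?andbF ?andbT.
- exact: trivIset1.
- by move=> a; rewrite inE => /eqP->; apply: domino_set2.
- apply/mirror_invariantP => a; rewrite !inE => /eqP->.
  by rewrite mirror_imset2 mirrorK setUC.
- rewrite coverD; apply/subsetP => x; rewrite !inE.
  by case/orP => /eqP->; rewrite ?axis_dist_mirror.
move=> i i_in; rewrite defJ //; congr (_ + _)%N; apply/esym.
case: eqP => [eq_i|neq_i].
  rewrite /= -(cards1 d); apply: eq_card => a; rewrite !inE.
  case: eqP => //= ->; apply/subsetP => x; rewrite in_set2.
  by case/orP => /eqP->; rewrite ?cellE ?axis_dist_mirror s1 eq_i !eqxx.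
rewrite eq_card0 // => a; rewrite !inE; apply/negP => /andP[/eqP-> /subsetP].
by move/(_ s); rewrite cellE !inE eqxx => /(_ isT)/andP[_ /eqP].
Qed.

(** Each tiling is counted once, at the unique partner of [s]. *)
Lemma card_split_partner P J s : P (axis_dist s) s.2 ->
  #|valid_tilings (region_of n P) J| =
  \sum_(t | adjacent s t)
     #|[set T in valid_tilings (region_of n P) J | [set s; t] \in T]|.
Proof.
move=> Ps; set V := valid_tilings _ _.
transitivity (\sum_(t | adjacent s t) \sum_(T in V) ([set s; t] \in T : nat)).
  rewrite exchange_big -sum1_card; apply: eq_bigr => T TV /=.
  have [domT covT _ eqT _] := valid_tilingsP TV.
  have [d dT sd] := covT s Ps.
  have [t adj def_d] := domino_pair (domT d dT) sd.
  rewrite (bigD1 t) //= -def_d dT big1 // => t' /andP[adj' neq].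
  case: (boolP (_ \in T)) => // dT'; case/eqP: neq.
  have := eqT _ _ dT' dT s; rewrite sd !inE eqxx => /(_ isT isT).
  rewrite def_d => /setP/(_ t'); rewrite !inE eqxx orbT.
  by rewrite eq_sym (negbTE (adjacent_neq adj')) => /esym/eqP.
clearbody V; apply: eq_bigr => t _; rewrite -sum1_card big_mkcond [RHS]big_mkcond /=.
by apply: eq_bigr => T _; rewrite in_set; case: (T \in V); case: (_ \in T).
Qed.

Lemma eq_region P P' J : P =2 P' ->
  #|valid_tilings (region_of n P) J| =
  #|valid_tilings (region_of n P') J|.
Proof.
by move=> eqP'; congr #|pred_of_set (valid_tilings _ _)|; apply/setP => s;
  rewrite !inE eqP'.
Qed.

Lemma half_square l y : (1 <= l <= n)%N -> (y < n.*2)%N ->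
  exists s, [/\ (s.1 < n)%N, (s.1 = n - l :> nat)%N, axis_dist s = l & s.2 = y :> nat].
Proof.
move=> l_in lty; have ltx : (n - l < n.*2)%N by lia.
exists (Ordinal ltx, Ordinal lty); split=> //=; first by lia.
by case: (axis_distP (Ordinal ltx, Ordinal lty)) => -[/= ? ->]; lia.
Qed.

(** With nothing below or to the left, the partner is above, one column nearer the axis, or across
    the axis. In column 1 the zero quota bars the last choice, and for odd [y] a vertical domino
    does not stay inside a cell. *)
Lemma peel_square P J l y :
  (forall l y, P l y -> (1 <= l <= n)%N && (y < n.*2)%N) ->
  P l y -> (forall y', y = y'.+1 -> ~~ P l y') -> ~~ P l.+1 y ->
  (l = 1%N -> J y./2.+1 = 0%N /\ odd y || ~~ P l y.+1) ->
  #|valid_tilings (region_of n P) J| =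
  ((if P l y.+1 then
     #|valid_tilings (region_of n (remove (remove P l y) l y.+1)) J|
   else 0) +
   (if (1 < l)%N && P l.-1 y then
     #|valid_tilings (region_of n (remove (remove P l y) l.-1 y)) J|
   else 0))%N.
Proof.
move=> inP Ply below left_l cellJ.
have /andP[l_in lty] := inP _ _ Ply.
have y_half : (1 <= y./2.+1 <= n)%N by clear -lty; lia.
have [s [lts s1 dist_s s2]] := half_square l_in lty.
rewrite (card_split_partner _ (s := s)) ?dist_s ?s2 //.
set c1 := (X in (X + _)%N); set c2 := (X in (_ + X)%N).
pose up t := (t.1 == s.1 :> nat) && (t.2 == y.+1 :> nat).
pose right t := [&& (t.1 == s.1.+1 :> nat), (t.2 == y :> nat) & (1 < l)%N].
transitivity (\sum_(t : square) ((if up t then c1 else 0) + (if right t then c2 else 0)))%N.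
  rewrite big_mkcond; apply: eq_bigr => t _ /=.
  have lt2 := ltn_ord t.1.
  have card0 : ~~ P (axis_dist t) t.2 ->
      #|[set T in valid_tilings (region_of n P) J | [set s; t] \in T]| = 0%N.
    move=> nPt; apply: eq_card0 => T; rewrite in_set; apply/negP => /andP[TV inT].
    have [_ _ /(_ _ inT t) regT _ _] := valid_tilingsP TV.
    by move: nPt; rewrite regT ?set22.
  have removal : (t.1 < n)%N -> adjacent s t ->
      (P (axis_dist t) t.2 ->
       ~~ ((l == 1%N) && (axis_dist t == 1%N) && (y./2 == (t.2)./2))) ->
      #|[set T in valid_tilings (region_of n P) J | [set s; t] \in T]| =
      if P (axis_dist t) t.2 then #|valid_tilings (region_of n
        (remove (remove P l y) (axis_dist t) t.2)) J| else 0%N.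
    move=> ltt adj not_cell; case: ifP => [Pt|/negbT]; last exact: card0.
    by rewrite card_pair_removal ?dist_s ?s2 // not_cell.
  case: (boolP (up t)) => [/andP[/eqP t1 /eqP t2]|not_up].
    have dist_t : axis_dist t = l by case: (axis_distP t) => -[? ->]; lia.
    have adj : adjacent s t by rewrite adjacentE t1 t2 s2 !eqxx.
    have -> : right t = false by rewrite /right t1; apply/negbTE; lia.
    rewrite adj addn0 removal ?dist_t ?t2 //; first by rewrite t1.
    move=> Pup; apply/negP => /andP[/andP[/eqP l1 _] half_y].
    by have [_] := cellJ l1; rewrite Pup orbF; lia.
  case: (boolP (right t)) => [/and3P[/eqP t1 /eqP t2 lt1l]|not_right].
    have dist_t : axis_dist t = l.-1 by case: (axis_distP t) => -[? ->]; lia.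
    have adj : adjacent s t by rewrite adjacentE t1 t2 s2 !eqxx orbT.
    rewrite adj add0n removal ?dist_t ?t2 /c2 ?lt1l //; first by rewrite t1; lia.
    by move=> _; rewrite (gtn_eqF lt1l).
  case: (boolP (adjacent s t)) => // adj.
  have [ts|] := eqVneq t (mirror s).
    have l1 : l = 1%N.
      move: adj; rewrite ts adjacentE mirror1 mirror2; lia.
    have [J0 _] := cellJ l1.
    apply: eq_card0 => T; rewrite in_set; apply/negP => /andP[TV inT].
    have := valid_cell TV (i := y./2.+1); rewrite J0.
    rewrite y_half; move=> /(_ isT)/eqP; rewrite cards_eq0 => /eqP/setP/(_ [set s; t]).
    rewrite in_set0 in_set inT /= => /negbT/negP; apply.
    apply/subsetP => x; rewrite in_set2 => /orP[]/eqP->;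
      by rewrite cellE ?ts ?axis_dist_mirror ?mirror2 dist_s l1 s2 !eqxx.
  rewrite square_eq mirror1 mirror2 => not_mirror.
  apply: card0; move: adj not_up not_right; rewrite adjacentE /up /right.
  case/orP => /andP[/eqP e1 /orP[]/eqP e2].
  - by rewrite -e1 -e2 s2 !eqxx.
  - have -> : axis_dist t = l by case: (axis_distP t) => -[? ->]; lia.
    by move=> _ _; apply: below; rewrite -s2.
  - rewrite -e1 -e2 s2 !eqxx /= => _; rewrite -leqNgt => le1l.
    by move: not_mirror; lia.
  have -> : axis_dist t = l.+1 by case: (axis_distP t) => -[? ->]; lia.
  by rewrite -e1 s2.
rewrite big_split /=; congr (_ + _)%N; rewrite -big_mkcond /=.
  rewrite /c1; case: ifP => [Pup|_]; last by rewrite big1.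
  have /andP[_ lty1] := inP _ _ Pup.
  by rewrite (big_pred1 (s.1, Ordinal lty1)).
rewrite /c2; case: ifP => [/andP[lt1l Pr]|_]; last by rewrite big1.
have ltx : (s.1.+1 < n.*2)%N by lia.
rewrite (big_pred1 (Ordinal ltx, s.2)) // => t.
by rewrite -[RHS]/(t == _) square_eq /right lt1l andbT s2.
Qed.

(** The only domino inside cell [k.+1] equals its mirror image, because the cell and the tiling are
    symmetric. Hence it crosses the axis, in row [k.*2] or [k.*2.+1]. *)
Lemma peel_cell P J J' k :
  (forall l y, P l y -> (1 <= l <= n)%N && (y < n.*2)%N) -> (k < n)%N ->
  (forall i, (1 <= i <= n)%N -> J i = ((k.+1 == i) + J' i)%N) ->
  J k.+1 = 1%N ->
  #|valid_tilings (region_of n P) J| =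
  ((if P 1 k.*2 then
     #|valid_tilings (region_of n (remove P 1 k.*2)) J'|
   else 0) +
   (if P 1 k.*2.+1 then
     #|valid_tilings (region_of n (remove P 1 k.*2.+1)) J'|
   else 0))%N.
Proof.
move=> inP ltkn defJ J1.
have one_in : (1 <= 1 <= n)%N by lia.
have lty : (k.*2 < n.*2)%N by lia.
have lty' : (k.*2.+1 < n.*2)%N by lia.
have [a [lta a1 dist_a a2]] := half_square one_in lty.
have [b [ltb b1 dist_b b2]] := half_square one_in lty'.
set V := valid_tilings _ _.
have in_cell s : s \in diagonal_cell n k.+1 ->
    [|| s == a, s == b, s == mirror a | s == mirror b].
  rewrite cellE !square_eq !mirror1 !mirror2 a1 a2 b1 b2.
  have lt1 := ltn_ord s.1.
  by case: (axis_distP s) => -[? ->]; lia.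
have cell_T T : T \in V ->
    ([set a; mirror a] \in T) (+) ([set b; mirror b] \in T).
  move=> TV; have := valid_cell TV (i := k.+1); rewrite J1.
  have -> : (1 <= k.+1 <= n)%N by lia.
  move=> /(_ isT)/eqP/cards1P[d eq_d].
  have : d \in [set d] by rewrite set11.
  rewrite -eq_d inE => /andP[dT sub_d].
  have [domT _ _ _ symT] := valid_tilingsP TV.
  have sub_cell (c : square) : c \in [set a; b] ->
      [set c; mirror c] \subset diagonal_cell n k.+1.
    rewrite in_set2 => eq_c; apply/subsetP => x; rewrite in_set2 => eq_x.
    rewrite cellE; case/orP: eq_x => /eqP->; rewrite ?axis_dist_mirror ?mirror2;
    case/orP: eq_c => /eqP->; rewrite ?dist_a ?dist_b ?a2 ?b2; lia.
  have inT (c : square) : c \in [set a; b] ->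
      ([set c; mirror c] \in T) = ([set c; mirror c] == d).
    move=> /sub_cell sub_c; have /setP/(_ [set c; mirror c]) := eq_d.
    by rewrite !inE sub_c andbT.
  rewrite !inT ?set21 ?set22 //.
  have md : @mirror n @: d = d.
    apply/set1P; rewrite -eq_d inE symT //=; apply/subsetP => _ /imsetP[x xd ->].
    by have := subsetP sub_d x xd; rewrite !cellE axis_dist_mirror.
  have [c c_in eq_dc] : exists2 c, c \in [set a; b] & d = [set c; mirror c].
    have [/existsP[s /existsP[t /andP[adj /eqP def_d]]]] := domT d dT.
    have def_t : t = mirror s.
      have : mirror s \in d by rewrite -md imset_f // def_d set21.
      rewrite def_d !inE => /orP[|/eqP //]; rewrite square_eq mirror1; lia.
    have sd : s \in d by rewrite def_d set21.
    have := in_cell s (subsetP sub_d s sd); rewrite def_d def_t.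
    case/or4P => /eqP->; rewrite ?mirrorK.
    - by exists a; rewrite ?set21.
    - by exists b; rewrite ?set22.
    - by exists a; rewrite ?set21 // setUC.
    by exists b; rewrite ?set22 // setUC.
  have neq_ab : [set a; mirror a] != [set b; mirror b].
    apply/eqP => /setP/(_ a); rewrite !inE eqxx !square_eq mirror2 a2 b2; lia.
  rewrite eq_dc; move: c_in; rewrite !inE => /orP[]/eqP->; rewrite eqxx.
    by rewrite eq_sym (negbTE neq_ab).
  by rewrite (negbTE neq_ab).
rewrite (_ : #|V| = #|[set T in V | [set a; mirror a] \in T]| +
                    #|[set T in V | [set b; mirror b] \in T]|)%N; last first.
  rewrite -cardsUI [X in (_ + X)%N]eq_card0 ?addn0 => [|T]; last first.
    rewrite in_setI [in X in X && _]in_set [in X in _ && X]in_set.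
    apply/negP => /andP[/andP[/cell_T + inTa] /andP[_ inTb]].
    by rewrite inTa inTb.
  apply: eq_card => T; rewrite in_setU [in X in X || _]in_set [in X in _ || X]in_set.
  rewrite -andb_orr; case: (boolP (T \in V)) => //= /cell_T.
  by do 2!case: (_ \in T).
have half c y : axis_dist c = 1%N -> c.2 = y :> nat -> y./2 = k ->
   #|[set T in V | [set c; mirror c] \in T]| = if P 1 y then
     #|valid_tilings (region_of n (remove P 1 y)) J'| else 0%N.
  move=> dist_c c2 y2; case: ifP => Pc; last first.
    apply: eq_card0 => T; rewrite in_set; apply/negP => /andP[TV inT].
    have [_ _ /(_ _ inT c) regT _ _] := valid_tilingsP TV.
    by move: regT; rewrite dist_c c2 Pc set21 => /(_ isT).
  have := @card_axis_removal P J J' c dist_c; rewrite dist_c c2 y2; apply=> //.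
by rewrite (half a _ dist_a a2) ?(half b _ dist_b b2) //; lia.
Qed.

Lemma card_valid_empty P J : (forall l y, ~~ P l y) ->
  (forall i, (1 <= i <= n)%N -> J i = 0%N) ->
  #|valid_tilings (region_of n P) J| = 1%N.
Proof.
move=> P0 J0; rewrite -(cards1 (set0 : {set {set square}})).
apply: eq_card => T; rewrite in_set1.
have -> : region_of n P = set0 :> {set square}.
  by apply/setP => s; rewrite !inE (negbTE (P0 _ _)).
rewrite inE /tiling partition_set0.
case: eqP => //= ->; apply/and3P; split.
- by apply/forall_inP => d; rewrite inE.
- by apply/mirror_invariantP => d; rewrite inE.
apply/allP => i i_in; rewrite J0; last by move: i_in; rewrite mem_iota; lia.
by rewrite cards_eq0; apply/eqP/setP => d; rewrite !inE.
Qed.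
End Peeling.

(** * Strips *)

Section Strips.
Variable n : nat.
Implicit Types (b w c : pred nat) (B S U : seq nat) (J : nat -> nat).

(* The left half of the region made of the strips from [k] on, when the black and
   white squares available in strip [k] are given by [b] and [w] and the black
   ones of strip [k.+1] by [c].  In column [l], counted from the axis, the black
   square of strip [k] is in row [l + 2k - 1], the white one in row [l + 2k]. *)
Definition strip k b w c (l y : nat) : bool :=
  [&& (0 < l)%N, (l + k.*2 <= y.+1)%N, (y + l <= n.*2)%N,
      (y.+1 == l + k.*2)%N ==> b l, (y == l + k.*2)%N ==> w l &
      (y == (l + k.*2).+1)%N ==> c l].

(* The number of dominoes still required in cell [i] once the cells [1..k] have
   got theirs. *)
Definition cell_quota k (i : nat) : nat := (k < i)%N.

Definition strip_count j k b w c : nat :=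
  #|valid_tilings (region_of n (strip k b w c)) (cell_quota j)|.

Lemma strip_in k b w c l y :
  strip k b w c l y -> (1 <= l <= n)%N && (y < n.*2)%N.
Proof. by case/and4P => ? ? ? _; lia. Qed.

(** The bound [y + l <= n.*2] leaves [n - k] columns in strip [k] and one fewer in strip [k.+1]. *)
Lemma eq_strip_count j k b w c b' w' c' :
  {in [pred i | 0 < i <= n - k]%N, b =1 b'} ->
  {in [pred i | 0 < i <= n - k]%N, w =1 w'} ->
  {in [pred i | 0 < i < n - k]%N, c =1 c'} ->
  strip_count j k b w c = strip_count j k b' w' c'.
Proof.
move=> eqb eqw eqc; apply: eq_region => l y; rewrite /strip.
case: (ltnP 0 l) => //= l0; case: leqP => //= ley; case: leqP => //= leyl.
congr [&& _, _ & _].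
- by case: eqP => //= ?; apply: eqb; rewrite inE; lia.
- by case: eqP => //= ?; apply: eqw; rewrite inE; lia.
by case: eqP => //= ?; apply: eqc; rewrite inE; lia.
Qed.

(** Below black [s] and to its left there is nothing of the strips from [k] on; white [s] is above
    it, white [s.-1] beside it. *)
Lemma peel_black j k b w c s :
  (1 < s)%N -> (s + k <= n)%N -> b s ->
  strip_count j k b w c =
  ((if w s then strip_count j k [pred i | b i & i != s] [pred i | w i & i != s] c
    else 0) +
   (if w s.-1 then
      strip_count j k [pred i | b i & i != s] [pred i | w i & i != s.-1] c
    else 0))%N.
Proof.
case: s => [|[|s]] // _ les bs; have ys : (s.+1 + k.*2).+1 = (s.+2 + k.*2)%N by lia.
rewrite /strip_count (@peel_square n _ _ s.+2 (s.+1 + k.*2)) //=; first last.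
- by rewrite /strip; lia.
- by move=> y' ?; rewrite /strip; lia.
- by rewrite /strip bs ys eqxx /= !ltn_eqF ?implyFb //=; lia.
- by move=> l y; apply: strip_in.
congr (_ + _)%N.
  have -> : strip k b w c s.+2 (s.+1 + k.*2).+1 = w s.+2.
    rewrite /strip; case: (w _); lia.
  case: ifP => // _; apply: eq_region => l y; rewrite /remove /strip /=.
  case: (b l); case: (w l); case: (c l); lia.
have -> : strip k b w c s.+1 (s.+1 + k.*2) = w s.+1.
  rewrite /strip; case: (w _); lia.
case: ifP => // _; apply: eq_region => l y; rewrite /remove /strip /=.
case: (b l); case: (w l); case: (c l); lia.
Qed.

(** With the blacks of strip [k] gone, white [l] touches blacks [l] and [l.-1] of strip [k.+1],
    where black [n - k] does not exist. For [l = 1], crossing the axis is barred since [k < j] makes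
    the quota of cell [k.+1] zero. *)
Lemma peel_white j k w c l : (k < j)%N ->
  (0 < l)%N -> (l + k <= n)%N -> w l ->
  strip_count j k pred0 w c =
  ((if (l + k < n)%N && c l then
      strip_count j k pred0 [pred i | w i & i != l] [pred i | c i & i != l]
    else 0) +
   (if (1 < l)%N && c l.-1 then
      strip_count j k pred0 [pred i | w i & i != l] [pred i | c i & i != l.-1]
    else 0))%N.
Proof.
move=> ltkj l0 lel wl.
rewrite /strip_count (@peel_square n _ _ l (l + k.*2)) //=; first last.
- move=> l1; rewrite /cell_quota l1; split; lia.
- by rewrite /strip /=; lia.
- by move=> y' ?; rewrite /strip /=; lia.
- rewrite /strip wl /=; lia.
- by move=> ? ?; apply: strip_in.
congr (_ + _)%N.
  have -> : strip k pred0 w c l (l + k.*2).+1 = (l + k < n)%N && c l.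
    rewrite /strip; case: (c _) => /=; lia.
  case: ifP => // _; apply: eq_region => l' y; rewrite /remove /strip /=.
  case: (w l'); case: (c l'); lia.
have -> : (1 < l)%N && strip k pred0 w c l.-1 (l + k.*2) = (1 < l)%N && c l.-1.
  rewrite /strip; case: (c _) => /=; lia.
case: ifP => // _; apply: eq_region => l' y; rewrite /remove /strip /=.
case: (w l'); case: (c l'); lia.
Qed.

Local Notation F := (bform n.+2).

Lemma seqpf_split pre post (u v w : nat -> int) : (forall i, w i = u i + v i) ->
  seqpf F (pre ++ w :: post) = seqpf F (pre ++ u :: post) + seqpf F (pre ++ v :: post).
Proof.
by move=> eqw; apply: seqpf_add => t; [apply: bform_addr | apply: bform_addl].
Qed.

(** * One strip: its whites, its blacks, its cell *)

Section Whites.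
Variables k : nat.
(** The induction hypothesis on the number of strips: with strip [k] used up, what remains starts
    with the blacks [S] of strip [k.+1]. *)
Hypothesis next_count : forall S, sorted ltn S ->
  {in S, forall i, 0 < i < n - k}%N ->
  (strip_count k.+1 k pred0 pred0 (mem S))%:Z = seqpf A S.

Lemma next_count_evec S : sorted ltn S -> {in S, forall i, 0 < i < n - k}%N ->
  (strip_count k.+1 k pred0 pred0 (mem S))%:Z = seqpf F (map evec S).
Proof.
move=> sorted_S rangeS; rewrite next_count //; apply/esym/seqpf_map.
by move=> i j /rangeS ? /rangeS ?; apply: bform_ee; lia.
Qed.

(* The whites of strip [k] are treated in increasing order; the next one is [l],
   [B] contains the blacks of the next strip that will stay uncovered, and black
   [l.-1] is still available in the first claim, already used in the second. *)
Lemma count_whites_step m l B U : (n - k).+1 = (m + l)%N -> (0 < l)%N ->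
  sorted ltn U -> {in U, forall i, l <= i <= n - k}%N ->
  sorted ltn B -> {in B, forall i, 0 < i}%N ->
  ((1 < l)%N -> {in B, forall i, i < l.-1}%N ->
   (strip_count k.+1 k pred0 [pred i | (l <= i)%N & i \notin U]
      [pred i | (i \in B) || (l.-1 <= i)%N])%:Z =
   seqpf F (map evec B ++ gaps l.-1 U)) /\
  ((l <= n - k)%N -> {in B, forall i, i.+1 < l}%N ->
   (strip_count k.+1 k pred0 [pred i | (l <= i)%N & i \notin U]
      [pred i | (i \in B) || (l <= i)%N])%:Z =
   if U is u :: U' then seqpf F (map evec B ++ gaps u U') else 0).
Proof.
elim: m l B U => [|m IHm] l B U def_m l0 sortU rangeU sortB posB.
  have U0 : U = [::].
    case: U rangeU {sortU} => // u U /(_ u); rewrite mem_head; lia.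
  rewrite U0 /=; split=> [_ ltB|]; last by lia.
  rewrite cats0 -next_count_evec //; last first.
    by move=> i iB; rewrite posB //; have := ltB i iB; lia.
  congr _%:Z; apply: eq_strip_count => i; rewrite !inE //=; first by lia.
  by move=> ltin; rewrite [(l.-1 <= i)%N](_ : _ = false) ?orbF //; lia.
case: l def_m l0 rangeU => // l def_m _ rangeU.
have sortB1 x : {in B, forall i, i < x}%N -> sorted ltn (rcons B x).
  case: B sortB {posB} => //= b0 B sortB ltB.
  by rewrite rcons_path sortB /=; apply: ltB; apply: mem_last.
have posB1 x : (0 < x)%N -> {in rcons B x, forall i, 0 < i}%N.
  by move=> x0 i; rewrite mem_rcons inE => /orP[/eqP ->//|/posB].
(* Without white [l.+1], no remaining white reaches black [l]: if still available, it joins [B], and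
   the gap from [l] to [l.+1] is [evec l]. *)
case: (boolP (l.+1 \in U)) => [inU|notinU].
  have [U' defU] : exists U', U = l.+1 :: U'.
    case: U sortU rangeU inU => // u U /= sortU rangeU.
    have := rangeU u (mem_head _ _); rewrite inE.
    case: eqP => [<- _ _|neq lu /= inU]; first by exists U.
    have /allP/(_ _ inU) /= := order_path_min ltn_trans sortU; lia.
  move: sortU rangeU; rewrite {U inU}defU /= => sortU rangeU.
  have sortU' := path_sorted sortU.
  have rangeU' : {in U', forall i, l.+2 <= i <= n - k}%N.
    move=> i iU'; have /allP/(_ i iU') /= := order_path_min ltn_trans sortU.
    by have := rangeU i; rewrite inE iU' orbT => /(_ isT); lia.
  have def_m' : ((n - k).+1 = m + l.+2)%N by lia.
  split=> [lt1l ltB|leln ltB].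
    have [//|IHa _] := IHm l.+2 (rcons B l) U' def_m' isT sortU' rangeU' (sortB1 _ ltB).
      by apply: posB1; lia.
    have ltB' : {in rcons B l, forall i, i < l.+1}%N.
      by move=> i; rewrite mem_rcons inE => /orP[/eqP ->//|/ltB]; lia.
    rewrite -[dvec l l.+1]/(evec l) -cat_rcons -map_rcons.
    rewrite -(IHa isT ltB'); congr _%:Z; apply: eq_strip_count => i; rewrite !inE //=.
      by case: (i \in U'); lia.
    by rewrite mem_rcons inE; case: (i \in B); lia.
  have [IHa _] := IHm l.+2 B U' def_m' isT sortU' rangeU' sortB posB.
  have ltB' : {in B, forall i, i < l.+1}%N by move=> i /ltB; lia.
  rewrite -(IHa isT ltB'); congr _%:Z; apply: eq_strip_count => i; rewrite !inE //=.
  by case: (i \in U'); lia.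
(* White [l.+1] is present. In the first claim it takes black [l] or black [l.+1], and the two
   counts add up by splitting the first gap at [l.+1]; in the second only black [l.+1] is
   possible. *)
have rangeU' : {in U, forall i, l.+2 <= i <= n - k}%N.
  move=> i iU; have := rangeU i iU; case: (eqVneq i l.+1) => [eqi|]; last by lia.
  by rewrite -eqi iU in notinU.
have def_m' : ((n - k).+1 = m + l.+2)%N by lia.
have lelk : (l.+1 + k <= n)%N by lia.
have [IHa IHb] := IHm l.+2 B U def_m' isT sortU rangeU' sortB posB.
split=> [lt1l ltB|leln ltB].
  have [|_ IHb1] := IHm l.+2 (rcons B l) U def_m' isT sortU rangeU' (sortB1 _ ltB).
    by apply: posB1; lia.
  rewrite (@peel_white _ _ _ _ l.+1) //=; last by rewrite leqnn.
  rewrite leqnSn leqnn !orbT andbT lt1l /= PoszD.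
  have -> : (strip_count k.+1 k pred0
     [pred i | [pred i0 | (l < i0)%N & i0 \notin U] i & i != l.+1]
     [pred i | [pred i0 | (i0 \in B) || (l <= i0)%N] i & i != l])%:Z =
     seqpf F (map evec B ++ gaps l.+1 U).
    rewrite -IHa //; last by move=> i /ltB; lia.
    congr _%:Z; apply: eq_strip_count => i _; rewrite !inE //=.
      by case: (i \in U); lia.
    by case: (boolP (i \in B)) => [/ltB|]; lia.
  (* At the last white, black [l.+1] does not exist and [U] is empty. *)
  have [lt_lk|ge_lk] := ltnP (l.+1 + k) n; last first.
    rewrite add0r; case: U {IHa IHb IHb1 sortU notinU rangeU} rangeU' => // u U /(_ u).
    by rewrite mem_head => /(_ isT); lia.
  have -> : (strip_count k.+1 k pred0
     [pred i | [pred i0 | (l < i0)%N & i0 \notin U] i & i != l.+1]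
     [pred i | [pred i0 | (i0 \in B) || (l <= i0)%N] i & i != l.+1])%:Z =
     if U is u :: U' then seqpf F (map evec (rcons B l) ++ gaps u U') else 0.
    rewrite -IHb1; first last.
    - by move=> i; rewrite mem_rcons inE => /orP[/eqP ->//|/ltB]; lia.
    - by lia.
    congr _%:Z; apply: eq_strip_count => i _; rewrite !inE //=.
      by case: (i \in U); lia.
    by rewrite mem_rcons inE; case: (boolP (i \in B)) => [/ltB|]; lia.
  case: U {IHa IHb IHb1 sortU notinU rangeU} rangeU' => [|u U] rangeU'.
    by rewrite add0r.
  have lt_lu := rangeU' u (mem_head _ _).
  rewrite map_rcons cat_rcons /= -(@seqpf_split _ _ _ _ (dvec l u)) // => i.
  by apply: dvecD; lia.
rewrite (@peel_white _ _ _ _ l.+1) //=; last by rewrite leqnn.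
rewrite leqnn orbT andbT.
have -> : (l \in B) || (l < l)%N = false.
  by rewrite ltnn orbF; apply/negP => /ltB; rewrite ltnn.
rewrite andbF addn0; case: ifP => [lt_lk|]; last first.
  case: U {IHa IHb sortU notinU rangeU} rangeU' => // u U /(_ u).
  by rewrite mem_head => /(_ isT); lia.
rewrite -IHb; first last.
- by move=> i /ltB; lia.
- by lia.
congr _%:Z; apply: eq_strip_count => i _; rewrite !inE //=.
  by case: (i \in U); lia.
by case: (boolP (i \in B)) => [/ltB|]; lia.
Qed.

(** The scan starts at [l = 1] with the second claim, as there is no black 0. *)
Lemma count_whites U : (k < n)%N -> sorted ltn U ->
  {in U, forall i, 0 < i <= n - k}%N ->
  (strip_count k.+1 k pred0 [pred i | i \notin U] predT)%:Z =
  seqpf F (star :: map (dvec 0) U).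
Proof.
move=> ltkn sortU rangeU.
have [//|_ stepb] :=
  @count_whites_step _ 1 [::] U (esym (addn1 (n - k))) isT sortU rangeU isT.
have -> : strip_count k.+1 k pred0 [pred i | i \notin U] predT =
  strip_count k.+1 k pred0 [pred i | (1 <= i)%N & i \notin U]
    [pred i | (i \in [::]) || (1 <= i)%N].
  by apply: eq_strip_count => i; rewrite !inE //= => /andP[-> _].
rewrite stepb //; last by lia.
(* For empty [U] there is one white more than blacks of strip [k.+1], matching the zero Pfaffian of
   [star] alone. *)
case: U sortU rangeU {stepb} => [|u U] sortU rangeU.
  by rewrite seqpf_isolated.
have /andP[u0 _] := rangeU u (mem_head _ _).
by rewrite seqpf_star_gaps //; apply: sub_sorted sortU => a b /ltnW.
Qed.

(** The least black [s] takes white [s] or white [s.-1], which then joins [U] as its new last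
    element; the two choices are the summands of [hvec s]. *)
Lemma count_blacks S U : (k < n)%N -> sorted ltn U ->
  {in U, forall i, 0 < i <= n - k}%N ->
  sorted ltn S -> {in S, forall i, 1 < i <= n - k}%N ->
  {in U & S, forall u s, u < s}%N ->
  (strip_count k.+1 k (mem S) [pred i | i \notin U] predT)%:Z =
  seqpf F (star :: map (dvec 0) U ++ map hvec S).
Proof.
move=> ltkn; elim: S U => [|s S IHS] U sortU rangeU sortS rangeS ltUS.
  by rewrite cats0 -count_whites.
have /andP[lt1s les] := rangeS s (mem_head _ _).
have ltUs : {in U, forall u, u < s}%N by move=> u uU; apply: ltUS; rewrite ?mem_head.
have sortS' := path_sorted sortS.
have ltsS : {in S, forall i, s < i}%N.
  by apply/allP; apply: order_path_min sortS; apply: ltn_trans.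
have rangeS' : {in S, forall i, 1 < i <= n - k}%N.
  by move=> i iS; apply: rangeS; rewrite inE iS orbT.
have IH x : (0 < x <= s)%N -> {in U, forall u, u < x}%N ->
    (strip_count k.+1 k [pred i | mem (s :: S) i & i != s]
      [pred i | [pred i0 | i0 \notin U] i & i != x] predT)%:Z =
    seqpf F (star :: map (dvec 0) U ++ dvec 0 x :: map hvec S).
  move=> x_in ltUx; rewrite -cat_rcons -map_rcons -IHS //.
  - congr _%:Z; apply: eq_strip_count => i _ //.
      rewrite -[LHS]/((i \in s :: S) && (i != s)) -[RHS]/(i \in S) inE.
      by case: (boolP (i \in S)) => [/ltsS|]; lia.
    rewrite -[LHS]/((i \notin U) && (i != x)) -[RHS]/(i \notin rcons U x).
    by rewrite mem_rcons inE negb_or andbC.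
  - case: U sortU ltUx {ltUS rangeU ltUs} => //= u U sortU ltUx.
    by rewrite rcons_path sortU; apply: ltUx; apply: mem_last.
  - move=> i; rewrite mem_rcons inE => /orP[/eqP ->|/rangeU //]; lia.
  move=> u v; rewrite mem_rcons inE => /orP[/eqP ->|uU] vS.
    by have := ltsS v vS; lia.
  by apply: ltUS; rewrite // inE vS orbT.
rewrite (@peel_black _ _ _ _ _ s) ?inE ?eqxx //; last by lia.
have -> : s \notin U by apply/negP => /ltUs; rewrite ltnn.
rewrite PoszD IH //; last by lia.
rewrite map_cons -!cat_cons.
rewrite (@seqpf_split _ _ (dvec 0 s) (dvec 0 s.-1) (hvec s)) => [|i]; last first.
  by rewrite /hvec gtn_eqF.
congr (_ + _); case: ifP => [s1U|/negbFE s1U].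
  rewrite IH //; first by lia.
  move=> u uU; have := ltUs u uU; case: (eqVneq u s.-1) => [eq_u|]; last by lia.
  by rewrite eq_u -[_ \in _]negbK s1U in uU.
(* White [s.-1] is already missing and is the last element of [U], so the second Pfaffian has two
   equal neighbours. *)
have [U0 ->] : exists U0, U = rcons U0 s.-1.
  case/lastP: U sortU ltUs s1U {IH ltUS rangeU} => // U u sortU ltUs s1U.
  exists U; congr rcons; apply/eqP; rewrite eqn_leq.
  have ltus : (u < s)%N by apply: ltUs; rewrite mem_rcons mem_head.
  apply/andP; split; first by lia.
  move: s1U; rewrite mem_rcons inE => /orP[/eqP -> //|s1U].
  have : pairwise ltn (rcons U u) by rewrite -(sorted_pairwise ltn_trans).
  by rewrite pairwise_rcons => /andP[/allP/(_ _ s1U)/ltnW].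
by rewrite map_rcons -rcons_cons cat_rcons seqpf_alt // bform_alt.
Qed.

(** The domino across the axis in cell [k.+1] covers black 1, leaving [U] empty and [star] as the
    vector of 1, or white 1, leaving [U = [:: 1]]. The second case survives only if black 1 is
    absent. *)
Lemma count_strip S : (k < n)%N -> sorted ltn S ->
  {in S, forall i, 0 < i <= n - k}%N ->
  (strip_count k k (mem S) predT predT)%:Z = seqpf A S.
Proof.
move=> ltkn sortS rangeS.
have J_split i : (1 <= i <= n)%N ->
    cell_quota k i = ((k.+1 == i) + cell_quota k.+1 i)%N.
  by rewrite /cell_quota; lia.
have J1 : cell_quota k k.+1 = 1%N by rewrite /cell_quota ltnSn.
rewrite /strip_count (peel_cell (@strip_in k _ _ _) ltkn J_split J1).
have -> : strip k (mem S) predT predT 1 k.*2 = (1%N \in S).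
  by rewrite /strip /=; case: (1%N \in S); lia.
have -> : strip k (mem S) predT predT 1 k.*2.+1 by rewrite /strip /=; lia.
have -> : #|valid_tilings (region_of n
      (remove (strip k (mem S) predT predT) 1 k.*2.+1)) (cell_quota k.+1)| =
    strip_count k.+1 k (mem S) [pred i | i \notin [:: 1%N]] predT.
  apply: eq_region => l y; rewrite /remove /strip /= !inE.
  case: (l \in S); lia.
have rangeS2 S' : {subset S' <= S} -> 1%N \notin S' ->
    {in S', forall i, 1 < i <= n - k}%N.
  move=> subS nS' i iS'; have := rangeS i (subS i iS').
  by case: (eqVneq i 1%N) => [i1|]; [rewrite -i1 iS' in nS' | lia].
have M1 : (1 < n.+2)%N by [].
have in_M (S' : seq nat) : {in S', forall i, 1 < i <= n - k}%N ->
    {in S', forall i, 1 < i < n.+2}%N.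
  by move=> rng i /rng; lia.
case: (boolP (1%N \in S)) => [S1|nS1]; last first.
  rewrite add0n count_blacks //.
  - by rewrite seqpf_star_d1_hvec //; apply/in_M/rangeS2.
  - by move=> i; rewrite inE => /eqP ->; lia.
  - exact: rangeS2.
  by move=> u s; rewrite inE => /eqP -> /(rangeS2 S (fun _ => id) nS1); lia.
have [S0 defS] : exists S0, S = 1%N :: S0.
  case: S sortS rangeS S1 {J_split rangeS2 in_M} => // s S sortS rangeS.
  have := rangeS s (mem_head _ _); rewrite inE.
  case: eqP => [<- _ _|neq ls /= inS]; first by exists S.
  have /allP/(_ _ inS) /= := order_path_min ltn_trans sortS; lia.
have gtS0 : {in S0, forall i, 1 < i}%N.
  apply/allP; apply: (order_path_min ltn_trans).
  by move: sortS; rewrite defS.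
have sortS0 : sorted ltn S0 by move: sortS; rewrite defS => /path_sorted.
have rangeS0 : {in S0, forall i, 1 < i <= n - k}%N.
  apply: rangeS2 => [i iS0|]; first by rewrite defS inE iS0 orbT.
  by apply/negP => /gtS0.
have -> : #|valid_tilings (region_of n
      (remove (strip k (mem S) predT predT) 1 k.*2)) (cell_quota k.+1)| =
    strip_count k.+1 k (mem S0) [pred i | i \notin [::]] predT.
  apply: eq_region => l y; rewrite /remove /strip /= defS !inE.
  by case: (boolP (l \in S0)) => [/gtS0|]; lia.
(* With white 1 gone and the quota of the cell spent, black 1 has no partner. *)
have -> : strip_count k.+1 k (mem S) [pred i | i \notin [:: 1%N]] predT = 0%N.
  rewrite /strip_count (@peel_square n _ _ 1 k.*2) //=.
  - by rewrite ifF //; rewrite /strip /=; lia.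
  - exact: strip_in.
  - by rewrite /strip /= S1; lia.
  - by move=> y ?; rewrite /strip /=; lia.
  - by rewrite /strip /=; lia.
  by move=> _; rewrite /cell_quota /strip /=; split; lia.
by rewrite addn0 count_blacks // seqpf_star_hvec ?defS //; apply: in_M.
Qed.

End Whites.

Lemma strip_count_pf k S : (k <= n)%N -> sorted ltn S ->
  {in S, forall i, 0 < i <= n - k}%N ->
  (strip_count k k (mem S) predT predT)%:Z = seqpf A S.
Proof.
have [m] := ubnP (n - k); elim: m k S => // m IHm k S lt_m lekn sortS rangeS.
case: (ltnP k n) => [ltkn|lenk]; last first.
  have -> : S = [::].
    case: S rangeS {sortS} => // s S /(_ s); rewrite mem_head; lia.
  rewrite /strip_count card_valid_empty // => [l y|i i_in].
    by rewrite /strip /=; lia.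
  by rewrite /cell_quota; lia.
apply: count_strip => // S' sortS' rangeS'.
(* An empty strip [k] followed by the blacks [S'] is the region that starts at strip [k.+1]. *)
rewrite -(IHm k.+1) //; last by move=> i /rangeS'; lia.
  congr _%:Z; apply: eq_region => l y; rewrite /strip /=.
  by case: (l \in S'); lia.
by lia.
Qed.

(** * The given region as a union of strips *)

Lemma ADE (s : square n) :
  (s \in AD n) = (axis_dist s <= s.2.+1)%N && (s.2 + axis_dist s <= n.*2)%N.
Proof.
have lt1 := ltn_ord s.1; have lt2 := ltn_ord s.2.
rewrite inE /AD_cond /corner /=.
set a : int := _ - _; set c : int := (s.2)%:Z - _.
(* Doubling turns the half-integer inequality into one between integers. *)
have half (z : int) : z%:Q + 2^-1 = (2 * z + 1)%:Q / 2.
  by rewrite intrD intrM; field.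
rewrite !half !normrM !(@ger0_norm _ 2^-1) // -mulrDl ler_pdivrMr //.
rewrite -!intr_norm -intrD -[n%:Q * 2]/(n%:Q * 2%:Q) -intrM ler_int.
rewrite /a /c {half a c}.
by case: (axis_distP s) lt1 lt2 => -[+ ->];
  move: (nat_of_ord s.1) (nat_of_ord s.2); lia.
Qed.

End Strips.

Lemma in_bigcup_seq (K : Type) (E : finType) (r : seq K) (P : pred K)
    (D : K -> {set E}) x :
  (x \in \bigcup_(i <- r | P i) D i) = has (fun i => P i && (x \in D i)) r.
Proof.
elim: r => [|i r IHr]; first by rewrite big_nil inE.
by rewrite big_cons /=; case: (P i); rewrite ?inE IHr.
Qed.

(** The blacks of strip 0 lie in column [l] and row [l - 1]: they are the southwestern boundary
    squares, so [I] lists those present. *)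
Lemma region_strip n (I : seq nat) : {in I, forall i, 1 <= i <= n}%N ->
  region n I = region_of n (strip n 0 (mem I) predT predT).
Proof.
move=> rangeI; apply/setP => s; rewrite /region in_setD ADE [RHS]in_set /strip.
set l := axis_dist s.
have -> : (s \in \bigcup_(1 <= i < n.+1 | i \notin I)
     (sw_boundary n i :|: se_boundary n i)) =
    [&& (1 <= l <= n)%N, s.2.+1 == l & l \notin I].
  have in_b i : (0 < i)%N ->
      (s \in sw_boundary n i :|: se_boundary n i) = (l == i) && (s.2.+1 == l).
    move=> i0; have lt1 := ltn_ord s.1.
    rewrite in_setU ![s \in _]in_set /corner !xpair_eqE /l.
    case: (axis_distP s) => -[? ->]; lia.
  rewrite in_bigcup_seq; apply/hasP/and3P => [[i]|[l_in eq_y lI]].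
    rewrite mem_index_iota => i_in /andP[iI]; rewrite in_b; last by lia.
    by case/andP => /eqP -> ->; split=> //; lia.
  by exists l; rewrite ?mem_index_iota ?lI ?in_b ?eqxx //; lia.
have l_in : (1 <= l <= n)%N.
  by have := ltn_ord s.1; rewrite /l; case: (axis_distP s) => -[? ->]; lia.
rewrite l_in /= addn0 !implybT; move: l_in.
by case: (l \in I) => /=; lia.
Qed.

Theorem theorem1p2 (n : nat) (I : seq nat) (n_ge1 : (1 <= n)%N)
    (I_increasing : sorted ltn I) (I_range : {in I, forall i, (1 <= i <= n)%N})
    (I_nonempty : (1 <= size I)%N) :
  #|symmetric_tilings n I|%:Z = pf (A_sub I).
Proof.
rewrite /A_sub pf_seqpf -(@strip_count_pf n 0) ?subn0 //.
rewrite /strip_count -region_strip //; congr _%:Z.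
apply: eq_card => T; rewrite !inE; do 2 congr (_ && _).
by apply: eq_in_all => i; rewrite mem_iota /cell_quota => /andP[-> _].
Qed.
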